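(* There is a constant $C>0$ depending only on $d$, $g$ and $J$ such that the following holds. Let $\mathbf{u}_0,\mathbf{b}_0\in\mathcal{V}$ satisfy $\mathcal{L}[\mathbf{u}_0]=\mathbf{b}_0$, assume that $D(\mathcal{L})[\mathbf{u}_0]^{-1}$ exists and is bounded on $\mathcal{V}$, and set $$R=\frac{C\,\epsilon^{5/2}}{|||D(\mathcal{L})[\mathbf{u}_0]^{-1}|||}.$$ Then for any continuous load path $\mathbf{b}:[0,T]\to\mathcal{V}$ with $\mathbf{b}(t)\in B\!\left(\mathbf{b}_0,\frac{R}{2|||D(\mathcal{L})[\mathbf{u}_0]^{-1}|||}\right)$ for all $t\in[0,T]$, there exists a unique continuous solution path $\mathbf{u}(t)\in\mathcal{V}$ lying inside $B(\mathbf{u}_0,R)$ such that $$\mathcal{L}[\mathbf{u}(t)]=\mathbf{b}(t)\quad\text{for all }t\in[0,T].$$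
   Context: Let $d\in\{2,3\}$ and let $\Omega\subset\mathbb{R}^d$ be a bounded domain (connected open set) satisfying the interior cone condition: there are $\lambda>0$, $\theta>0$ such that every $\mathbf{x}\in\Omega$ is the apex of a spherical cone contained in $\Omega$ of radius $\lambda$ and aperture angle $2\theta$ (with axis along some unit vector $\mathbf{e}_{\mathbf{x}}$). Fix $\epsilon>0$ and let $H_\epsilon(\mathbf{x})$ be the ball of radius $\epsilon$ centered at $\mathbf{x}$; $\omega_d$ is the volume of the unit ball of $\mathbb{R}^d$; $\mathbf{e}_{\mathbf{y}-\mathbf{x}}=(\mathbf{y}-\mathbf{x})/|\mathbf{y}-\mathbf{x}|$. $J$ is a non-negative bounded measurable function supported on $[0,1]$ and $J^\epsilon(r)=J(r/\epsilon)$. The function $g:\mathbb{R}\to\mathbb{R}$ is three times continuously differentiable, $g,g',g'',g'''$ are bounded, $g(0)=0$, $g(r)>0$ for $r\ne0$, $g$ is convex on $(r^e,r^c)$ with $r^e<0<r^c$ and concave outside this interval, has finite limits at $\pm\infty$, and $\max_r|g''(r)|=g''(0)$. The strain is $S(\mathbf{y},\mathbf{x},\mathbf{u})=\frac{\mathbf{u}(\mathbf{y})-\mathbf{u}(\mathbf{x})}{|\mathbf{y}-\mathbf{x}|}\cdot\mathbf{e}_{\mathbf{y}-\mathbf{x}}$. The force operator is $$\mathcal{L}[\mathbf{u}](\mathbf{x})=-\int_{H_\epsilon(\mathbf{x})\cap\Omega}\frac{2J^\epsilon(|\mathbf{y}-\mathbf{x}|)}{\epsilon^{d+1}\omega_d\sqrt{|\mathbf{y}-\mathbf{x}|}}\,g'\!\left(\sqrt{|\mathbf{y}-\mathbf{x}|}\,S(\mathbf{y},\mathbf{x},\mathbf{u})\right)\mathbf{e}_{\mathbf{y}-\mathbf{x}}\,d\mathbf{y},$$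 and its Fréchet derivative is $$D(\mathcal{L})[\mathbf{u}]\Delta\mathbf{u}(\mathbf{x})=-\int_{H_\epsilon(\mathbf{x})\cap\Omega}\frac{2J^\epsilon(|\mathbf{y}-\mathbf{x}|)}{\epsilon^{d+1}\omega_d}\,g''\!\left(\sqrt{|\mathbf{y}-\mathbf{x}|}\,S(\mathbf{y},\mathbf{x},\mathbf{u})\right)S(\mathbf{y},\mathbf{x},\Delta\mathbf{u})\,\mathbf{e}_{\mathbf{y}-\mathbf{x}}\,d\mathbf{y}.$$ Let $\Pi=\{\mathbf{Q}\mathbf{x}+\mathbf{c}:\mathbf{Q}^T=-\mathbf{Q}\in\mathbb{R}^{d\times d},\ \mathbf{c}\in\mathbb{R}^d\}$ and $\mathcal{V}=\{\mathbf{u}\in L^\infty(\Omega;\mathbb{R}^d):\int_\Omega\mathbf{u}\cdot\mathbf{w}\,d\mathbf{x}=0\ \text{for all }\mathbf{w}\in\Pi\}$, with norm $\|\cdot\|_\infty$ (essential supremum); $\mathcal{L}$ and $D(\mathcal{L})[\mathbf{u}]$ map $\mathcal{V}$ to $\mathcal{V}$. $B(\hat{\mathbf{u}},R)=\{\mathbf{u}:\|\mathbf{u}-\hat{\mathbf{u}}\|_\infty\le R\}$. $|||D(\mathcal{L})[\mathbf{u}]^{-1}|||=\sup_{\mathbf{0}\ne\Delta\mathbf{u}\in\mathcal{V}}\|D(\mathcal{L})[\mathbf{u}]^{-1}\Delta\mathbf{u}\|_\infty/\|\Delta\mathbf{u}\|_\infty$. Continuity of paths is with respect to $\|\cdot\|_\infty$.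 *)

(* Defs.v *)
From HB Require Import structures.
From mathcomp Require Import all_boot all_order all_algebra.
From mathcomp Require Import all_classical all_reals all_analysis.
From mathcomp Require Import ess_sup_inf.

Set Implicit Arguments.
Unset Strict Implicit.
Unset Printing Implicit Defensive.

Import Order.TTheory GRing.Theory Num.Theory.
Import numFieldNormedType.Exports.

Local Open Scope classical_set_scope.
Local Open Scope ring_scope.

Definition rV_display : Type -> measure_display.
Proof. exact. Qed.

(* Row vectors carry the sigma-algebra generated by the coordinates, as
   n.-tuple does in the library; over R it is the Borel sigma-algebra. *)
Section measurable_rV.
Context {R : realType} {n : nat}.

Definition rV_coord (i : 'I_n) (x : 'rV[R]_n) : measurableTypeR R := x ord0 i.

Let rV_set0 : g_sigma_preimage rV_coord set0.
Proof. exact: sigma_algebra0. Qed.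

Let rV_setC A : g_sigma_preimage rV_coord A -> g_sigma_preimage rV_coord (~` A).
Proof. exact: sigma_algebraC. Qed.

Let rV_bigcup (F : _^nat) : (forall i, g_sigma_preimage rV_coord (F i)) ->
  g_sigma_preimage rV_coord (\bigcup_i (F i)).
Proof. exact: sigma_algebra_bigcup. Qed.

HB.instance Definition _ := @isMeasurable.Build
  (rV_display R) 'rV[R]_n
  (g_sigma_preimage rV_coord) rV_set0 rV_setC rV_bigcup.

End measurable_rV.

Section rV_cons.
Context {R : realType}.
Implicit Type n : nat.

Definition rV_cons n (p : measurableTypeR R * 'rV[R]_n) : 'rV[R]_n.+1 :=
  \row_j (if unlift ord0 j is Some k then p.2 ord0 k else p.1).

Lemma rV_cons0 n p : @rV_cons n p ord0 ord0 = p.1.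
Proof. by rewrite mxE unlift_none. Qed.

Lemma rV_consS n p (j : 'I_n) : @rV_cons n p ord0 (lift ord0 j) = p.2 ord0 j.
Proof. by rewrite mxE liftK. Qed.

Lemma measurable_rV_coord n (i : 'I_n) :
  measurable_fun [set: 'rV[R]_n] (rV_coord i).
Proof.
move=> _ Y mY; rewrite setTI; apply: sub_sigma_algebra => /=.
rewrite -bigcup_seq/=; exists i => /=; first by rewrite mem_index_enum.
by exists Y => //; rewrite setTI.
Qed.

Lemma measurable_fun_rV d (T : measurableType d) n (f : T -> 'rV[R]_n) :
  (forall i, measurable_fun [set: T] (rV_coord i \o f)) ->
  measurable_fun [set: T] f.
Proof.
move=> mf _ A mA.
have : g_sigma_preimage (fun i : 'I_n => rV_coord i \o f) `<=` measurable.
  apply: smallest_sub; first exact: sigma_algebra_measurable.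
  case: n => [|n] in f mf A mA *; first by rewrite big_ord0.
  rewrite -bigcup_mkord_ord; apply: bigcup_sub => i Ii.
  by move=> B [C mC <-]; exact: mf.
by apply; rewrite g_sigma_preimage_comp; exists A.
Qed.

Lemma measurable_rV_cons n : measurable_fun setT (@rV_cons n).
Proof.
apply: measurable_fun_rV => i; case: (unliftP ord0 i) => [j|] ->.
  rewrite (_ : _ \o _ = rV_coord j \o snd); last first.
    by apply/funext => p /=; rewrite /rV_coord rV_consS.
  by apply: measurableT_comp; [exact: measurable_rV_coord|exact: measurable_snd].
rewrite (_ : _ \o _ = fst); last first.
  by apply/funext => p /=; rewrite /rV_coord rV_cons0.
exact: measurable_fst.
Qed.

HB.instance Definition _ n :=
  isMeasurableFun.Build _ _ _ _ (@rV_cons n) (@measurable_rV_cons n).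

End rV_cons.

Section lebesgue_rV.
Context {R : realType}.

Section step.
Local Open Scope ereal_scope.
Context {n : nat} (m : {sigma_finite_measure set 'rV[R]_n -> \bar R}).

Definition leb_step : set 'rV[R]_n.+1 -> \bar R :=
  pushforward (@lebesgue_measure R \x m) (@rV_cons R n).

Let step0 : leb_step set0 = 0.
Proof. exact: measure0. Qed.

Let step_ge0 A : 0 <= leb_step A.
Proof. exact: measure_ge0. Qed.

Let step_sigma_additive : semi_sigma_additive leb_step.
Proof. exact: measure_semi_sigma_additive. Qed.

HB.instance Definition _ := isMeasure.Build _ _ _ leb_step
  step0 step_ge0 step_sigma_additive.

Let step_sigma_finite : sigma_finite setT leb_step.
Proof.
have /sigma_finiteP[F [TF ndF Foo]] := sigma_finiteT (@lebesgue_measure R).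
have /sigma_finiteP[G [TG ndG Goo]] := sigma_finiteT m.
pose h (x : 'rV[R]_n.+1) : measurableTypeR R * 'rV[R]_n :=
  (x ord0 ord0 : measurableTypeR R, \row_j x ord0 (lift ord0 j)).
have mh : measurable_fun setT h.
  apply/measurable_fun_pairP; split; first exact: (measurable_rV_coord ord0).
  apply: measurable_fun_rV => i; rewrite (_ : _ \o _ = rV_coord (lift ord0 i)).
    exact: measurable_rV_coord.
  by apply/funext => x /=; rewrite /rV_coord mxE.
have hK : cancel (@rV_cons R n) h.
  move=> [x y]; rewrite /h rV_cons0; congr pair.
  by apply/rowP => j; rewrite mxE rV_consS.
exists (fun k => h @^-1` (F k `*` G k)).
  apply/seteqP; split => // x _.
  have [i _ Fi] : (\bigcup_i F i) (h x).1 by rewrite -TF.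
  have [j _ Gj] : (\bigcup_j G j) (h x).2 by rewrite -TG.
  exists (maxn i j) => //; split.
    by move: Fi; exact/subsetPset/ndF/leq_maxl.
  by move: Gj; exact/subsetPset/ndG/leq_maxr.
move=> k; have [mF Fk] := Foo k; have [mG Gk] := Goo k; split.
  by rewrite -[X in measurable X]setTI; apply: mh => //; exact: measurableX.
rewrite /leb_step /pushforward (_ : _ @^-1` _ = F k `*` G k); last first.
  by apply/seteqP; split => z; rewrite /preimage /mkset hK.
by rewrite product_measure1E// lte_mul_pinfty// ge0_fin_numE.
Qed.

HB.instance Definition _ := Measure_isSigmaFinite.Build _ _ _ leb_step
  step_sigma_finite.

End step.

Fixpoint lebesgue_rV n : {sigma_finite_measure set 'rV[R]_n -> \bar R} :=
  if n is k.+1 then leb_step (lebesgue_rV k) else dirac (0 : 'rV[R]_0).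

Lemma lebesgue_rV_box n (A : 'I_n -> set (measurableTypeR R)) :
  (forall i, measurable (A i)) ->
  lebesgue_rV n [set x | forall i, A i (x ord0 i)] =
  (\prod_(i < n) lebesgue_measure (A i))%E.
Proof.
elim: n A => [|n IHn] A mA.
  by rewrite big_ord0 /= diracE mem_set// => -[].
pose B := [set y : 'rV[R]_n | forall i, A (lift ord0 i) (y ord0 i)].
have mB : measurable B.
  rewrite (_ : B = \bigcap_(i in [set: 'I_n])
    (rV_coord i @^-1` A (lift ord0 i))).
    apply: fin_bigcap_measurable => // i _.
    by rewrite -[X in measurable X]setTI; exact: measurable_rV_coord.
  by apply/seteqP; split => x /= xA i; [move=> _; exact: xA|exact: (xA i)].
rewrite big_ord_recl -(IHn (fun i => A (lift ord0 i)))//.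
rewrite -[RHS]product_measure1E//= /leb_step /pushforward.
congr (_ _); apply/seteqP; split => -[x y] /=.
  move=> xyA; split => [|i]; first by have := xyA ord0; rewrite rV_cons0.
  by have := xyA (lift ord0 i); rewrite rV_consS.
move=> [xA yA] i; case: (unliftP ord0 i) => [j|] ->.
  by rewrite rV_consS; exact: yA.
by rewrite rV_cons0.
Qed.

End lebesgue_rV.

Section euclidean.
Context {R : realType} {d : nat}.
Implicit Types (u v x y : 'rV[R]_d) (Om : set 'rV[R]_d).

Definition dotv u v : R := \sum_(i < d) u ord0 i * v ord0 i.

(* The norm provided by the library on 'rV[R]_d is the sup norm. *)
Definition enorm v : R := Num.sqrt (dotv v v).

Definition eball x (r : R) : set 'rV[R]_d := [set y | enorm (y - x) < r].

Definition dir y x : 'rV[R]_d := (enorm (y - x))^-1 *: (y - x).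

Definition ball_volume : R := fine (lebesgue_rV d (eball 0 1)).

Definition bounded_domain Om :=
  [/\ Om !=set0, open Om, connected Om &
      exists M : R, forall x, Om x -> enorm x <= M].

(* cone with apex x, axis e, radius lambda and aperture angle 2 theta *)
Definition spherical_cone x (e : 'rV[R]_d) (lambda theta : R) :
    set 'rV[R]_d :=
  [set y | enorm (y - x) <= lambda /\
           enorm (y - x) * cos theta <= dotv (y - x) e].

(* The bound theta < pi makes cos theta faithful to the angle, cos being
   decreasing on [0, pi]. *)
Definition interior_cone_condition Om :=
  exists lambda theta : R, [/\ 0 < lambda, 0 < theta, theta < pi &
    forall x, Om x -> exists2 e : 'rV[R]_d, enorm e = 1 &
      spherical_cone x e lambda theta `<=` Om].

End euclidean.

Section constitutive.
Context {R : realType}.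
Implicit Types J g : R -> R.

Definition influence_function J :=
  [/\ measurable_fun setT J, (forall r, 0 <= J r),
      (exists M : R, forall r, J r <= M) &
      (forall r, r \notin `[0, 1] -> J r = 0)].

Definition convex_on (I : interval R) g :=
  convex_function (E := R^o) [set` I] g.

Definition potential g :=
  [/\ [/\ (forall k, (k < 3)%N -> forall r, derivable (derive1n k g) r 1),
          continuous (derive1n 3 g) &
          (forall k, (k <= 3)%N -> exists M : R, forall r, `|derive1n k g r| <= M)],
      g 0 = 0 /\ (forall r, r != 0 -> 0 < g r),
      (exists re rc : R, [/\ re < 0, 0 < rc, convex_on `]re, rc[ g &
        convex_on `]-oo, re] (\- g) /\ convex_on `[rc, +oo[ (\- g)]),
      cvg (g r @[r --> -oo]) /\ cvg (g r @[r --> +oo]) &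
      (forall r, `|derive1n 2 g r| <= derive1n 2 g 0)].

End constitutive.

(* Elements of L^oo(Om; R^d) are represented by functions that are measurable
   on Om; what they do outside Om is irrelevant, and equality of two of them
   is equality almost everywhere in Om. *)
Section fields.
Context {R : realType} {d : nat} (Om : set 'rV[R]_d).
Local Notation field := ('rV[R]_d -> 'rV[R]_d).
Implicit Types (u v w : field) (A B : field -> field).

Definition field_eq u v := u = v %[ae lebesgue_rV d in Om].

(* Extending the norm by 0 outside Om does not affect its essential supremum
   over Om, provided that Om is not negligible. *)
Definition norm_oo u : \bar R :=
  ess_sup (lebesgue_rV d) ((fun x => (enorm (u x))%:E) \_ Om).

Definition rigid_motion w :=
  exists (Q : 'M[R]_d) (c : 'rV[R]_d),
    Q^T = - Q /\ w = (fun x => x *m Q^T + c).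

Definition Vspace u :=
  [/\ measurable_fun Om u, (norm_oo u < +oo)%E &
      forall w, rigid_motion w ->
        \int[lebesgue_rV d]_(x in Om) dotv (u x) (w x) = 0].

Definition Vball u0 (r : R) u := Vspace u /\ (norm_oo (u \- u0)%R <= r%:E)%E.

(* B is the inverse of A : V -> V; the second clause says that B is well
   defined on classes of fields. *)
Definition V_inverse A B :=
  [/\ (forall f, Vspace f -> Vspace (B f)),
      (forall f f', Vspace f -> Vspace f' ->
        field_eq f f' -> field_eq (B f) (B f')),
      (forall f, Vspace f -> field_eq (A (B f)) f) &
      (forall v, Vspace v -> field_eq (B (A v)) v)].

Definition op_norm B : \bar R :=
  ereal_sup [set (fine (norm_oo (B f)) / fine (norm_oo f))%:E |
             f in [set f | Vspace f /\ ~ field_eq f (cst 0)]].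

Definition V_path (T : R) (u : R -> field) :=
  forall t, t \in `[0, T] -> Vspace (u t) /\
    norm_oo (u s \- u t) @[s --> within [set` `[0, T]] (nbhs t)] --> 0%E.

End fields.

Section peridynamics.
Context {R : realType} {d : nat}.
Variables (g J : R -> R) (Om : set 'rV[R]_d) (eps : R).
Local Notation field := ('rV[R]_d -> 'rV[R]_d).
Implicit Types u du : field.

Definition strain y x u : R :=
  dotv ((enorm (y - x))^-1 *: (u y - u x)) (dir y x).

Definition vec_integral (D : set 'rV[R]_d) (F : field) : 'rV[R]_d :=
  \row_i \int[lebesgue_rV d]_(y in D) F y ord0 i.

Definition force u : field := fun x =>
  - vec_integral (eball x eps `&` Om) (fun y => let r := enorm (y - x) in
      (2 * J (r / eps) / (eps ^+ d.+1 * ball_volume (R := R) (d := d) * Num.sqrt r)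
       * derive1n 1 g (Num.sqrt r * strain y x u)) *: dir y x).

Definition Dforce u du : field := fun x =>
  - vec_integral (eball x eps `&` Om) (fun y => let r := enorm (y - x) in
      (2 * J (r / eps) / (eps ^+ d.+1 * ball_volume (R := R) (d := d))
       * derive1n 2 g (Num.sqrt r * strain y x u) * strain y x du) *: dir y x).

Definition solution_path (T : R) (b : R -> field) u0 (r : R)
    (u : R -> field) :=
  [/\ V_path Om T u,
      (forall t, t \in `[0, T] -> Vball Om u0 r (u t)) &
      (forall t, t \in `[0, T] -> field_eq Om (force (u t)) (b t))].

End peridynamics.

(* Main.v *)
Require Import Defs.
From mathcomp Require Import all_boot all_order all_algebra.
From mathcomp Require Import all_classical all_reals all_analysis.
From mathcomp Require Import measurable_realfun ess_sup_inf ring lra zify.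

(** Write L for the force operator, A for its derivative at u0, B for the
    inverse of A and N for the norm of B. The solution for a load b is the limit
    of the chord iteration u + B (b - L u), started at u0.

    It converges because L is close to A near u0. If u and v lie within rad of
    u0 and are at distance c, then L u - L v - A (u - v) is at most
    K * rad * c / eps ^ (5/2) (remainder_bounded, remainder_scaling). Indeed the
    mean value theorem, applied twice, bounds the linearization error of g' by
    the product of two terms sqrt r * strain, where r is the length of the bond
    and a strain is at most 2 / r times the sup norm of the field. With the
    weight r ^ (-1/2) of the force the integrand is of order r ^ (-3/2), which
    is integrable over a ball of radius eps in dimension at least 2, with an
    integral of order eps ^ (d - 3/2) (integral_singular_le); the normalization
    eps ^ (d + 1) leaves eps ^ (-5/2). With rad = C * eps ^ (5/2) / N, the
    remainder composed with B is at most K * C * c, hence c / 2 for small C.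

    Two consequences follow for any pair L, A with this property. First, L is
    injective on the ball with a 2 N - Lipschitz inverse (newton_stability),
    which gives uniqueness at once, and the continuity of the solution path from
    that of the load path. Second, the steps of the iteration halve, the first
    being at most N * rad / (2 N) = rad / 2, so the iterates stay in the ball
    and converge to a solution (newton_solution).

    The iteration takes place in V, so L and A must map V to itself. This holds
    for every operator that integrates a symmetric kernel k(x, y) times the
    direction of the bond (Vspace_kop): its work against a rigid motion is the
    double integral of an antisymmetric function (kop_rigid). The measurability
    in x comes from the joint measurability of the kernel, and V is closed for
    uniform limits (Vspace_closed). *)

Set Implicit Arguments.
Unset Strict Implicit.
Unset Printing Implicit Defensive.
Import Order.TTheory GRing.Theory Num.Theory.
Import numFieldNormedType.Exports.
Local Open Scope classical_set_scope.
Local Open Scope ring_scope.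

(** * Euclidean norm and measurability in coordinates *)

Section euclidean_norm.
Context {R : realType} {d : nat}.
Implicit Types (u v w x y : 'rV[R]_d) (a : R).

Lemma dotvC u v : dotv u v = dotv v u.
Proof. by apply: eq_bigr => i _; rewrite mulrC. Qed.

Lemma dotvDl u v w : dotv (u + v) w = dotv u w + dotv v w.
Proof. by rewrite -big_split; apply: eq_bigr => i _; rewrite mxE mulrDl. Qed.

Lemma dotvZl a u v : dotv (a *: u) v = a * dotv u v.
Proof. by rewrite mulr_sumr; apply: eq_bigr => i _; rewrite mxE mulrA. Qed.

Lemma dotvNl u v : dotv (- u) v = - dotv u v.
Proof. by rewrite -scaleN1r dotvZl mulN1r. Qed.

Lemma dotvBl u v w : dotv (u - v) w = dotv u w - dotv v w.
Proof. by rewrite dotvDl dotvNl. Qed.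

Lemma dotvDr u v w : dotv u (v + w) = dotv u v + dotv u w.
Proof. by rewrite dotvC dotvDl !(dotvC _ u). Qed.

Lemma dotvZr a u v : dotv u (a *: v) = a * dotv u v.
Proof. by rewrite dotvC dotvZl dotvC. Qed.

Lemma dotvNr u v : dotv u (- v) = - dotv u v.
Proof. by rewrite dotvC dotvNl dotvC. Qed.

Lemma dot0v v : dotv 0 v = 0.
Proof. by rewrite -(scale0r 0) dotvZl mul0r. Qed.

Lemma dotvv_ge0 v : 0 <= dotv v v.
Proof. by apply: sumr_ge0 => i _; rewrite -expr2 sqr_ge0. Qed.

Lemma dotvv_eq0 v : dotv v v = 0 -> v = 0.
Proof.
move=> /eqP; rewrite psumr_eq0 => [/allP v0|i _]; last by rewrite -expr2 sqr_ge0.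
apply/rowP => i; rewrite mxE; have := v0 i (mem_index_enum _).
by rewrite mulf_eq0 orbb => /eqP.
Qed.

Lemma enorm_ge0 v : 0 <= enorm v. Proof. exact: sqrtr_ge0. Qed.

Lemma enorm_sqr v : enorm v ^+ 2 = dotv v v.
Proof. by rewrite sqr_sqrtr// dotvv_ge0. Qed.

Lemma enorm0 : enorm (0 : 'rV[R]_d) = 0.
Proof. by rewrite /enorm dot0v sqrtr0. Qed.

Lemma enorm_eq0 v : enorm v = 0 -> v = 0.
Proof. by move=> v0; apply: dotvv_eq0; rewrite -enorm_sqr v0 expr0n. Qed.

Lemma enormZ a v : enorm (a *: v) = `|a| * enorm v.
Proof.
by rewrite /enorm dotvZl dotvZr mulrA -expr2 sqrtrM ?sqr_ge0// sqrtr_sqr.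
Qed.

Lemma enormN v : enorm (- v) = enorm v.
Proof. by rewrite -scaleN1r enormZ normrN1 mul1r. Qed.

Lemma enormB u v : enorm (u - v) = enorm (v - u).
Proof. by rewrite -enormN opprB. Qed.

(** The squared length of (v.v) u - (u.v) v, a multiple of the component of u
    orthogonal to v, is (v.v) times the difference of the two squared sides. *)
Lemma cauchy_schwarz u v : `|dotv u v| <= enorm u * enorm v.
Proof.
have [v0|v0] := eqVneq (dotv v v) 0.
  by rewrite (dotvv_eq0 v0) enorm0 mulr0 dotvC dot0v normr0.
have vv : 0 < dotv v v by rewrite lt_def v0 dotvv_ge0.
rewrite -(ler_pXn2r (n := 2))// ?nnegrE ?mulr_ge0 ?enorm_ge0//.
rewrite exprMn !enorm_sqr real_normK ?num_real//.
have := dotvv_ge0 (dotv v v *: u - dotv u v *: v).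
rewrite !(dotvBl, dotvDr, dotvNr, dotvZl, dotvZr) (dotvC v u) => h.
have : 0 <= dotv v v * (dotv u u * dotv v v - dotv u v ^+ 2) by lra.
by rewrite pmulr_rge0// subr_ge0.
Qed.

Lemma enormD u v : enorm (u + v) <= enorm u + enorm v.
Proof.
rewrite -(ler_pXn2r (n := 2))// ?nnegrE ?addr_ge0 ?enorm_ge0//.
rewrite sqrrD !enorm_sqr dotvDl !dotvDr (dotvC v u).
have := le_trans (ler_norm _) (cauchy_schwarz u v); lra.
Qed.

Lemma enorm_triB u v : enorm (u - v) <= enorm u + enorm v.
Proof. by rewrite -(enormN v) enormD. Qed.

Lemma ler_coord_enorm v i : `|v ord0 i| <= enorm v.
Proof.
rewrite -(ler_pXn2r (n := 2))// ?nnegrE ?enorm_ge0// enorm_sqr.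
rewrite real_normK ?num_real// /dotv (bigD1 i)//= -expr2 lerDl.
by apply: sumr_ge0 => j _; rewrite -expr2 sqr_ge0.
Qed.

Lemma enorm_le_coord v a : (forall i, `|v ord0 i| <= a) -> enorm v <= d%:R * a.
Proof.
move=> va; have [d0|d0] := posnP d.
  rewrite {1}/enorm {1}/dotv big1 => [|i _]; first by rewrite sqrtr0 d0 mul0r.
  by have := ltn_ord i; rewrite [X in (_ < X)%N]d0.
have a0 : 0 <= a by exact: le_trans (normr_ge0 _) (va (Ordinal d0)).
rewrite -(ler_pXn2r (n := 2))// ?nnegrE ?mulr_ge0 ?enorm_ge0// enorm_sqr.
apply: (@le_trans _ _ (\sum_(i < d) a ^+ 2)).
  apply: ler_sum => i _; rewrite -expr2 -real_normK ?num_real//.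
  by rewrite ler_pXn2r ?nnegrE.
rewrite sumr_const card_ord -[leLHS]mulr_natl exprMn.
apply: ler_wpM2r; first exact: sqr_ge0.
by rewrite expr2 ler_peMl// ler1n.
Qed.

Lemma dirN x y : dir x y = - dir y x.
Proof. by rewrite /dir enormB -scalerN opprB. Qed.

Lemma enorm_dir_le1 x y : enorm (dir y x) <= 1.
Proof.
rewrite /dir enormZ ger0_norm ?invr_ge0 ?enorm_ge0//.
have [->|n0] := eqVneq (enorm (y - x)) 0; first by rewrite mulr0 ler01.
by rewrite mulVf.
Qed.

Lemma strainC (u : 'rV[R]_d -> 'rV[R]_d) x y : strain y x u = strain x y u.
Proof.
by rewrite /strain (dirN x y) (enormB y) -(opprB (u x)) scalerN dotvNl dotvNr.

Qed.

Lemma strainB (u v : 'rV[R]_d -> 'rV[R]_d) x y :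
  strain y x (u \- v) = strain y x u - strain y x v.
Proof.
rewrite /strain -dotvBl -scalerBr; congr (dotv (_ *: _) _) => /=.
by apply/rowP => i; rewrite !mxE; ring.
Qed.

(** A bound on the values of a field, in the absence of regularity, controls its
    strain at the cost of one power of the length of the bond. *)
Lemma strain_le (u : 'rV[R]_d -> 'rV[R]_d) x y m :
  enorm (u x) <= m -> enorm (u y) <= m ->
  `|strain y x u| <= 2 * m / enorm (y - x).
Proof.
move=> ux uy; apply: le_trans (cauchy_schwarz _ _) _.
rewrite enormZ ger0_norm ?invr_ge0 ?enorm_ge0// mulrC.
apply: le_trans (ler_wpM2r _ (enorm_dir_le1 _ _)) _.
  by rewrite mulr_ge0 ?invr_ge0 ?enorm_ge0.
rewrite mul1r mulrC ler_wpM2r ?invr_ge0 ?enorm_ge0//.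
apply: le_trans (enorm_triB _ _) _; lra.
Qed.

End euclidean_norm.

Section measurability.
Context {R : realType} {d : nat}.

Lemma measurable_coord_comp dT (T : measurableType dT) (D : set T)
    (f : T -> 'rV[R]_d) i : measurable_fun D f ->
  measurable_fun D (fun x => f x ord0 i : R).
Proof. by move=> mf; exact: measurableT_comp (measurable_rV_coord i) mf. Qed.

Lemma measurable_funT_rV dT (T : measurableType dT) (f : T -> 'rV[R]_d) :
  (forall i, measurable_fun setT (fun x => f x ord0 i : R)) ->
  measurable_fun setT f.
Proof. by move=> mf; apply: measurable_fun_rV => i; exact: mf. Qed.

Lemma measurable_patch_rV dT (T : measurableType dT) (D : set T)
    (f : T -> 'rV[R]_d) : measurable D ->
  (forall i, measurable_fun D (fun x => f x ord0 i : R)) ->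
  measurable_fun setT (patch (fun=> 0) D f).
Proof.
move=> mD mf; apply: measurable_funT_rV => i.
rewrite (_ : (fun _ => _) = ((fun x => f x ord0 i) \_ D)).
  by apply/(measurable_restrictT _ mD).
by apply/funext => x; rewrite /patch; case: ifP => // _; rewrite mxE.
Qed.

Lemma measurable_funD_rV dT (T : measurableType dT) (D : set T)
    (f : T -> 'rV[R]_d) : measurable D ->
  (forall i, measurable_fun D (fun x => f x ord0 i : R)) ->
  measurable_fun D f.
Proof.
move=> mD mf; apply: (@eq_measurable_fun _ _ _ _ D (patch (fun=> 0) D f)).
  by move=> x xD; rewrite patchT.
by apply: measurable_funTS; exact: measurable_patch_rV.
Qed.

Lemma measurable_dotv dT (T : measurableType dT) (D : set T)
    (f g : T -> 'rV[R]_d) : measurable_fun D f -> measurable_fun D g ->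
  measurable_fun D (fun x => dotv (f x) (g x)).
Proof.
move=> mf mg; apply: measurable_sum => i.
by apply: measurable_funM; exact: measurable_coord_comp.
Qed.

Lemma measurable_sqrt : measurable_fun setT (@Num.sqrt R).
Proof. by apply: continuous_measurable_fun => x; exact: sqrt_continuous. Qed.

Lemma measurable_enorm dT (T : measurableType dT) (D : set T)
    (f : T -> 'rV[R]_d) : measurable_fun D f ->
  measurable_fun D (fun x => enorm (f x)).
Proof.
by move=> mf; apply: measurableT_comp measurable_sqrt _; exact: measurable_dotv.
Qed.

Lemma measurable_rVB dT (T : measurableType dT) (f g : T -> 'rV[R]_d) :
  measurable_fun setT f -> measurable_fun setT g ->
  measurable_fun setT (fun x => f x - g x).
Proof.
move=> mf mg; apply: measurable_funT_rV => i; under eq_fun do rewrite mxE mxE.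
by apply: measurable_funB; exact: measurable_coord_comp.
Qed.

(** On nonnegative numbers the inverse, also at 0, is the power of exponent
    -1. *)
Lemma measurable_inv_ge0 dT (T : measurableType dT) (D : set T) (f : T -> R) :
  (forall x, 0 <= f x) -> measurable_fun D f ->
  measurable_fun D (fun x => (f x)^-1).
Proof.
move=> f0 mf; rewrite (_ : (fun _ => _) = (fun x => f x `^ (-1))).
  exact: (measurableT_comp (measurable_powR (-1)) mf).
by apply/funext => x; rewrite powR_inv1.
Qed.

(** The sigma-algebra of the coordinates contains the open sets because an open
    set is a union of rational boxes, of which there are countably many. *)
Lemma open_measurable_rV (A : set 'rV[R]_d) : open A -> measurable A.
Proof.
move=> oA.
pose B (p : 'rV[rat]_d * nat) : set 'rV[R]_d :=
  [set y | forall i, ball (ratr (p.1 ord0 i) : R) (p.2.+1%:R^-1) (y ord0 i)].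
have mB p : measurable (B p).
  rewrite (_ : B p = \bigcap_(i in [set: 'I_d])
    (rV_coord i @^-1` ball (ratr (p.1 ord0 i) : R) (p.2.+1%:R^-1))).
    apply: fin_bigcap_measurable => // i _.
    rewrite -[X in measurable X]setTI; apply: measurable_rV_coord => //.
    exact: measurable_ball.
  by apply/seteqP; split => x /= xA i; [move=> _; exact: xA|exact: (xA i)].
have -> : A = \bigcup_(p in [set p | B p `<=` A]) B p.
  apply/seteqP; split => [x Ax|x [p /= pA]]; last exact: pA.
  have /nbhs_ballP[e /= e0 eA] := open_nbhs_nbhs (conj oA Ax).
  have e2 : 0 < e / 2 by rewrite divr_gt0.
  have [n ne] : exists n : nat, n.+1%:R^-1 < e / 2 :> R.
    have [n _ /(_ n (leqnn _)) /= h] := near_infty_natSinv_lt (PosNum e2).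
    by exists n.
  have [r [rE re r0]] : exists r : R, [/\ r = n.+1%:R^-1, r < e / 2 & 0 < r].
    by exists (n.+1%:R^-1); split; rewrite ?invr_gt0.
  have q i : exists q : rat, `|x ord0 i - ratr q| < r.
    have xr : x ord0 i - r < x ord0 i + r by lra.
    have [q] := rat_in_itvoo xr.
    by rewrite in_itv/= => h; exists q; rewrite ltr_norml; lra.
  pose P i := [set q : rat | `|x ord0 i - ratr q| < r].
  pose p : 'rV[rat]_d * nat := (\row_i xget 0 (P i), n).
  have px i : `|x ord0 i - ratr (p.1 ord0 i)| < r.
    by rewrite mxE; have [q0 hq] := q i; exact: (xgetPex 0 (ex_intro (P i) _ hq)).
  exists p; last by move=> i; rewrite /ball/= -rE distrC px.
  (* coordinatewise, x and y are both within r < e / 2 of the centre of the box *)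
  move=> y /= yB; apply: eA; split=> // i j; rewrite (ord1 i) /ball/=.
  by have := px j; have := yB j; rewrite /ball/= -rE !ltr_norml; lra.
rewrite bigcup_mkcond; apply: countable_bigcupT_measurable => // p.
by case: ifP.
Qed.

End measurability.

(** * Integrability of the singular kernel *)

Section singular_kernel.
Context {R : realType} {d : nat}.
Local Notation mu := (@lebesgue_rV R d).
Implicit Types (x y : 'rV[R]_d) (eps : R).

Definition cube x (r : R) : set 'rV[R]_d :=
  [set y | forall i, `]x ord0 i - r, x ord0 i + r[%classic (y ord0 i)].

Lemma measurable_cube x r : measurable (cube x r).
Proof.
rewrite (_ : cube x r = \bigcap_(i in [set: 'I_d])
  (rV_coord i @^-1` `]x ord0 i - r, x ord0 i + r[)).
  apply: fin_bigcap_measurable => // i _.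
  rewrite -[X in measurable X]setTI; apply: measurable_rV_coord => //.
by apply/seteqP; split => y /= xA i; [move=> _; exact: xA|exact: (xA i)].
Qed.

Lemma volume_cube x r : 0 < r -> mu (cube x r) = ((2 * r) ^+ d)%:E.
Proof.
move=> r0.
rewrite (lebesgue_rV_box (A := fun i => `]x ord0 i - r, x ord0 i + r[%classic))//.
under eq_bigr => i _.
  rewrite lebesgue_measure_itv/= lte_fin ltrD2l gt0_cp// -EFinB.
  rewrite (_ : _ - _ = 2 * r); last by ring.
  over.
by rewrite prodEFin prodr_const card_ord.
Qed.

(** The function r ^ (-3/2) of the length r of the bond, cut off at the horizon
    eps. Up to constants it dominates all the kernels below, and it is
    integrable exactly because the dimension is at least 2. *)
Definition singular eps x y : R :=
  if enorm (y - x) < eps then (enorm (y - x) * Num.sqrt (enorm (y - x)))^-1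
  else 0.

Lemma singular_ge0 eps x y : 0 <= singular eps x y.
Proof.
by rewrite /singular; case: ifP => // _; rewrite invr_ge0 mulr_ge0// enorm_ge0.
Qed.

Lemma measurable_fun_sndBfst :
  measurable_fun setT (fun p : 'rV[R]_d * 'rV[R]_d => p.2 - p.1).
Proof. by apply: measurable_rVB; [exact: measurable_snd|exact: measurable_fst]. Qed.

Lemma measurable_singular eps :
  measurable_fun setT (fun p : 'rV[R]_d * 'rV[R]_d => singular eps p.1 p.2).
Proof.
have mr := measurable_enorm measurable_fun_sndBfst.
apply: measurable_fun_ifT => //; first exact: measurable_fun_ltr.
apply: measurable_inv_ge0 => [p|]; first by rewrite mulr_ge0// enorm_ge0.
by apply: measurable_funM => //; exact: measurableT_comp measurable_sqrt mr.
Qed.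

Section shells.
Variables (eps : R).
Hypothesis eps0 : 0 < eps.

(* wgt k is the value of r ^ (-3/2) at the inner radius rho k / 4 *)
Let rho k := eps * 4^-1 ^+ k.
Let wgt k := 8 / (rho k * Num.sqrt (rho k)).

Let rho_gt0 k : 0 < rho k.
Proof. by rewrite mulr_gt0// exprn_gt0. Qed.

Let rhoS k : rho k = 4 * rho k.+1.
Proof. by rewrite /rho exprS; field. Qed.

Let sqrt4 : Num.sqrt 4 = 2 :> R.
Proof. by rewrite (_ : 4 = 2 ^+ 2) ?sqrtr_sqr ?ger0_norm//; ring. Qed.

Let sqrt_rho k : Num.sqrt (rho k) = Num.sqrt eps * 2^-1 ^+ k.
Proof.
rewrite /rho sqrtrM ?ltW//; congr (_ * _).
rewrite (_ : 4^-1 ^+ k = (2^-1 ^+ k) ^+ 2 :> R); last first.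
  by rewrite -exprM mulnC exprM; congr (_ ^+ _); field.
by rewrite sqrtr_sqr ger0_norm// exprn_ge0.
Qed.

Let wgt_gt0 k : 0 < wgt k.
Proof. by rewrite divr_gt0// mulr_gt0// sqrtr_gt0. Qed.

Let shell x y : 0 < enorm (y - x) < eps ->
  exists2 k, cube x (rho k) y & singular eps x y <= wgt k.
Proof.
move=> /andP[r0 re].
have [k rk] : exists k, rho k <= enorm (y - x).
  have /cvgrPdist_lt/(_ _ (divr_gt0 r0 eps0)) : (4^-1 : R) ^+ n @[n --> \oo] --> 0.
    by apply: cvg_expr; rewrite ger0_norm//; lra.
  case=> k _ /(_ k (leqnn k)); rewrite sub0r normrN ger0_norm ?exprn_ge0// => h.
  by exists k; rewrite /rho mulrC -ler_pdivlMr// ltW.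
have exk : exists k, rho k <= enorm (y - x) by exists k.
case: (ex_minnP exk) => -[|m] hm mmin.
  by move: hm; rewrite /rho expr0 mulr1 leNgt re.
have rm : enorm (y - x) < rho m by rewrite ltNge; apply/negP => /mmin; rewrite ltnn.
exists m => [i|].
  have := le_lt_trans (ler_coord_enorm (y - x) i) rm.
  by rewrite !mxE ltr_norml /= in_itv/=; lra.
rewrite /singular re /wgt rhoS sqrtrM// sqrt4.
rewrite (_ : 8 / _ = (rho m.+1 * Num.sqrt (rho m.+1))^-1); last first.
  have := rho_gt0 m.+1; have : 0 < Num.sqrt (rho m.+1) by rewrite sqrtr_gt0.
  by move=> h1 h2; field; lra.
have sq r : 0 < r -> 0 < r * Num.sqrt r by move=> ?; rewrite mulr_gt0 ?sqrtr_gt0.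
rewrite lef_pV2 ?posrE ?sq//.
by apply: ler_pM => //; rewrite ?sqrtr_ge0 ?ler_wsqrtr// ltW.
Qed.

(** The ball is cut into shells whose radii shrink by a factor 4. On each shell
    the kernel is bounded by its value at the inner radius, and the shell lies
    in a cube whose volume is explicit; as d is at least 2, the products decay
    geometrically. *)
Lemma integral_singular_le x : (1 < d)%N ->
  (\int[mu]_y (singular eps x y)%:E <=
   (2 ^+ (d + 4) * (eps ^+ d.-2 * Num.sqrt eps))%:E)%E.
Proof.
move=> d1.
have m1 k : measurable_fun setT (fun y => (wgt k * \1_(cube x (rho k)) y)%:E).
  apply/measurable_EFinP; apply: measurable_funM => //.
  by apply: measurable_indic; exact: measurable_cube.
have p1 k y : (0 <= (wgt k * \1_(cube x (rho k)) y)%:E)%E.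
  by rewrite lee_fin mulr_ge0 ?(ltW (wgt_gt0 k)).
apply: (@le_trans _ _
  (\int[mu]_y \sum_(0 <= k <oo) (wgt k * \1_(cube x (rho k)) y)%:E)%E).
  apply: ge0_le_integral => //.
  - by move=> y _; rewrite lee_fin singular_ge0.
  - apply/measurable_EFinP.
    exact: (measurableT_comp (measurable_singular eps) (pair1_measurable x)).
  - by apply: ge0_emeasurable_sum.
  move=> y _; have [/shell[k xk yk]|] := boolP (0 < enorm (y - x) < eps).
    rewrite (@nneseriesD1 _ _ k)//.
    apply: (@le_trans _ _ (wgt k * \1_(cube x (rho k)) y)%:E).
      by rewrite lee_fin indicE mem_set// mulr1.
    by rewrite leeDl// nneseries_ge0.
  rewrite negb_and -leNgt -leNgt => h; rewrite [singular _ _ _](_ : _ = 0).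
    exact: nneseries_ge0.
  rewrite /singular; case: ifPn => // re.
  case/orP: h => h; last by move: re; rewrite ltNge h.
  have -> : enorm (y - x) = 0 by apply/eqP; rewrite eq_le h enorm_ge0.
  by rewrite mul0r invr0.
rewrite integral_nneseries//.
apply: lime_le; first by apply: is_cvg_nneseries => k _ _; exact: integral_ge0.
apply: nearW => n.
pose c := 2 ^+ d * 8 * (eps ^+ d.-2 * Num.sqrt eps).
have c0 : 0 <= c by rewrite !mulr_ge0 ?exprn_ge0 ?sqrtr_ge0 ?(ltW eps0).
have term k : (\int[mu]_y (wgt k * \1_(cube x (rho k)) y)%:E <= (c * 2^-1 ^+ k)%:E)%E.
  under eq_integral do rewrite EFinM.
  rewrite ge0_integralZl//; last 2 first.
  - by apply/measurable_EFinP; apply: measurable_indic; exact: measurable_cube.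
  - by rewrite lee_fin ltW.
  rewrite integral_indic ?setIT//; last exact: measurable_cube.
  rewrite [X in (_ * X)%E](volume_cube x (rho_gt0 k)) -EFinM lee_fin.
  have rk := rho_gt0 k; have sk : 0 < Num.sqrt (rho k) by rewrite sqrtr_gt0.
  have -> : wgt k * (2 * rho k) ^+ d = 2 ^+ d * 8 * (rho k ^+ d.-2 * Num.sqrt (rho k)).
    have -> : rho k ^+ d.-2 * Num.sqrt (rho k) = rho k ^+ d / (rho k * Num.sqrt (rho k)).
      apply/(canRL (mulfK _)); first by rewrite mulf_neq0 ?gt_eqF.
      rewrite [LHS](_ : _ = rho k ^+ d.-2 * rho k * Num.sqrt (rho k) ^+ 2); last by ring.
      by rewrite sqr_sqrtr ?(ltW rk)// -!exprSr -addn2 -subn2 subnK.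
    by rewrite /wgt exprMn; field; lra.
  rewrite /c -!mulrA !ler_pM2l ?exprn_gt0// sqrt_rho.
  rewrite ler_wpM2r ?mulr_ge0 ?sqrtr_ge0 ?exprn_ge0//.
  rewrite /rho exprMn ler_piMr ?exprn_ge0 ?(ltW eps0)//.
  by rewrite -exprM exprn_ile1//; lra.
apply: (@le_trans _ _ (\sum_(0 <= k < n) (c * 2^-1 ^+ k)%:E)%E); first exact: lee_sum.
rewrite sumEFin lee_fin -mulr_sumr.
have -> : 2 ^+ (d + 4) * (eps ^+ d.-2 * Num.sqrt eps) = c * 2.
  by rewrite /c exprD; ring.
rewrite ler_wpM2l//.
suff -> : \sum_(0 <= k < n) 2^-1 ^+ k = 2 - 2 * 2^-1 ^+ n :> R.
  by rewrite lerBlDr lerDl mulr_ge0// exprn_ge0.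
elim: n => [|n IH]; first by rewrite big_nil expr0; ring.
by rewrite big_nat_recr//= IH exprS; field.
Qed.

End shells.
End singular_kernel.

(** * Force fields of bond kernels *)

(** Fubini lets the order of integration be exchanged, and renaming the
    variables then changes the sign of the double integral. *)
Lemma integral_antisymmetric {R : realType} dT (T : measurableType dT)
    (m : {sigma_finite_measure set T -> \bar R}) (H : T * T -> R) :
  (m \x m)%E.-integrable setT (EFin \o H) ->
  (forall x y, H (y, x) = - H (x, y)) ->
  (\int[m]_x \int[m]_y (H (x, y))%:E = 0)%E.
Proof.
move=> iH antiH.
have /= sw := Fubini iH.
have : (\int[m]_x \int[m]_y (H (x, y))%:E = - \int[m]_x \int[m]_y (H (x, y))%:E)%E.
  rewrite {1}sw -integralN/=; last first.
    have := integrable_fubini_F iH; rewrite /fubini_F => iF.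
    exact: (integrable_add_def measurableT iF).
  apply: ae_eq_integral => //.
  - exact: measurable_fubini_G iH.
  - by apply: measurableT_comp => //; exact: measurable_fubini_F iH.
  have := ae_integrable1 iH; apply: filterS => x /= ix _.
  rewrite -integralN/=; last exact: (integrable_add_def measurableT ix).
  by apply: eq_integral => y _; rewrite antiH EFinN.
have : (\int[m]_x \int[m]_y (H (x, y))%:E \is a fin_num)%E.
  by have := integrable_fubini_F iH => /integrable_fin_num; apply.
case: (\int[m]_x \int[m]_y (H (x, y))%:E)%E => [r||]// _ [] rr.
by congr EFin; lra.
Qed.

Section kernel_operator.
Context {R : realType} {d : nat}.
Local Notation mu := (@lebesgue_rV R d).
Local Notation field := ('rV[R]_d -> 'rV[R]_d).
Implicit Types (x y : 'rV[R]_d) (k : 'rV[R]_d -> 'rV[R]_d -> R).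

(** An upper bound for the integral of the singular kernel, of the sharp order
    eps ^ (d - 3/2). *)
Definition singular_mass (eps : R) : R :=
  2 ^+ (d + 4) * (eps ^+ d.-2 * Num.sqrt eps).

(** The force field of a bond kernel: the points y act on x along the bond with
    the intensity k x y. *)
Definition kop k : field := fun x => \row_i \int[mu]_y (k x y * dir y x ord0 i).

Variables (Om : set 'rV[R]_d) (eps : R).
Hypotheses (d1 : (1 < d)%N) (eps0 : 0 < eps).

(** Fields are only essentially bounded, so the strain of a field, hence the
    kernels built from it, can be estimated only for almost every x and then
    for almost every y. *)
Definition admissible (c : R) k :=
  [/\ measurable_fun setT (fun p : 'rV[R]_d * 'rV[R]_d => k p.1 p.2),
      (forall x y, k x y = k y x), (forall x y, ~ Om x -> k x y = 0) &
      {ae mu, forall x, {ae mu, forall y, `|k x y| <= c * singular eps x y}}].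

Lemma singular_mass_ge0 : 0 <= singular_mass eps.
Proof. by rewrite !mulr_ge0 ?exprn_ge0 ?sqrtr_ge0 ?(ltW eps0). Qed.

Lemma singular_dom_integral_le c x (h : 'rV[R]_d -> R) : 0 <= c ->
  measurable_fun setT h ->
  {ae mu, forall y, `|h y| <= c * singular eps x y} ->
  (\int[mu]_y `|(h y)%:E| <= (c * singular_mass eps)%:E)%E.
Proof.
move=> c0 mh hc.
have ms : measurable_fun setT (fun y => (singular eps x y)%:E).
  apply/measurable_EFinP.
  exact: (measurableT_comp (measurable_singular eps) (pair1_measurable x)).
apply: (@le_trans _ _ (\int[mu]_y (c%:E * (singular eps x y)%:E))%E).
  apply: ae_ge0_le_integral => //.
  - by apply: measurableT_comp => //; exact/measurable_EFinP.
  - by move=> y _; rewrite -EFinM lee_fin mulr_ge0// singular_ge0.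
  - exact: measurable_funeM.
  by apply: filterS hc => y hy _; rewrite -EFinM lee_fin.
rewrite ge0_integralZl//; last by move=> y _; rewrite lee_fin singular_ge0.
by rewrite EFinM; apply: lee_wpmul2l => //; exact: integral_singular_le.
Qed.

Lemma singular_dom_integrable c x (h : 'rV[R]_d -> R) : 0 <= c ->
  measurable_fun setT h ->
  {ae mu, forall y, `|h y| <= c * singular eps x y} ->
  mu.-integrable setT (EFin \o h).
Proof.
move=> c0 mh hc; apply/integrableP; split; first exact/measurable_EFinP.
exact: le_lt_trans (singular_dom_integral_le c0 mh hc) (ltry _).
Qed.

Lemma singular_dom_Rintegral_le c x (h : 'rV[R]_d -> R) : 0 <= c ->
  measurable_fun setT h ->
  {ae mu, forall y, `|h y| <= c * singular eps x y} ->
  `|\int[mu]_y h y| <= c * singular_mass eps.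
Proof.
move=> c0 mh hc; rewrite -lee_fin EFin_normr_Rintegral//; last first.
  exact: singular_dom_integrable hc.
apply: le_trans (singular_dom_integral_le c0 mh hc).
by apply: le_abse_integral => //; exact/measurable_EFinP.
Qed.

Lemma measurable_dir_coord i : measurable_fun setT
  (fun p : 'rV[R]_d * 'rV[R]_d => dir p.2 p.1 ord0 i : R).
Proof.
under eq_fun do rewrite mxE.
apply: measurable_funM; last exact: measurable_coord_comp measurable_fun_sndBfst.
apply: measurable_inv_ge0 => [p|]; first exact: enorm_ge0.
exact: measurable_enorm measurable_fun_sndBfst.
Qed.

Section admissible_theory.
Variables (c : R) (k : 'rV[R]_d -> 'rV[R]_d -> R).
Hypotheses (c0 : 0 <= c) (kadm : admissible c k).

Lemma kop_integrand_measurable i : measurable_fun setT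
  (fun p : 'rV[R]_d * 'rV[R]_d => k p.1 p.2 * dir p.2 p.1 ord0 i).
Proof.
by case: kadm => mk _ _ _; apply: measurable_funM => //; exact: measurable_dir_coord.
Qed.

Lemma kop_integrand_measurable1 x i :
  measurable_fun setT (fun y => k x y * dir y x ord0 i).
Proof.
exact: (measurableT_comp (kop_integrand_measurable i) (pair1_measurable x)).
Qed.

Lemma kop_integrand_dom : {ae mu, forall x, {ae mu, forall y,
  forall i, `|k x y * dir y x ord0 i| <= c * singular eps x y}}.
Proof.
case: kadm => _ _ _; apply: filterS => x; apply: filterS => y h i.
rewrite normrM; apply: le_trans h; rewrite ler_piMr//.
exact: le_trans (ler_coord_enorm _ _) (enorm_dir_le1 _ _).
Qed.

Lemma kop_integrand_integrable : {ae mu, forall x, forall i,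
  mu.-integrable setT (EFin \o (fun y => k x y * dir y x ord0 i))}.
Proof.
apply: filterS kop_integrand_dom => x h i.
apply: (@singular_dom_integrable c x) => //; first exact: kop_integrand_measurable1.
by apply: filterS h => y; exact.
Qed.

(** Summing over the coordinates costs a factor d; it only affects the constant
    of the theorem. *)
Lemma kop_bounded :
  {ae mu, forall x, enorm (kop k x) <= d%:R * (c * singular_mass eps)}.
Proof.
apply: filterS kop_integrand_dom => x h.
apply: enorm_le_coord => i; rewrite mxE.
apply: (@singular_dom_Rintegral_le c x) => //; first exact: kop_integrand_measurable1.
by apply: filterS h => y; exact.
Qed.

(** The positive and negative parts are treated separately because, for the
    exceptional points x, the integral need not exist. *)
Lemma measurable_kop : measurable_fun setT (kop k).
Proof.
apply: measurable_funT_rV => i; under eq_fun do rewrite mxE.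
apply: measurableT_comp => //.
pose f (p : 'rV[R]_d * 'rV[R]_d) : \bar R := (k p.1 p.2 * dir p.2 p.1 ord0 i)%:E.
have mf : measurable_fun setT f.
  by apply/measurable_EFinP; exact: kop_integrand_measurable.
under eq_fun do rewrite integralE.
apply: emeasurable_funB.
- rewrite (_ : (fun _ => _) = fubini_F mu (f^\+)%E).
    by apply: measurable_fun_fubini_tonelli_F => //; exact: measurable_funepos.
  by apply/funext => x; apply: eq_integral => y _; rewrite !funeposE.
- rewrite (_ : (fun _ => _) = fubini_F mu (f^\-)%E).
    by apply: measurable_fun_fubini_tonelli_F => //; exact: measurable_funeneg.
  by apply/funext => x; apply: eq_integral => y _; rewrite !funenegE.
Qed.

End admissible_theory.

Lemma kopB c1 c2 k1 k2 : 0 <= c1 -> 0 <= c2 ->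
  admissible c1 k1 -> admissible c2 k2 ->
  {ae mu, forall x, kop (fun x y => k1 x y - k2 x y) x = kop k1 x - kop k2 x}.
Proof.
move=> c10 c20 a1 a2.
apply: filterS2 (kop_integrand_integrable c10 a1) (kop_integrand_integrable c20 a2).
move=> x i1 i2; apply/rowP => i; rewrite !mxE -RintegralB//.
by apply: eq_Rintegral => y _; rewrite mulrBl.
Qed.

End kernel_operator.

(** * Rigid motions and the space V *)

Section rigid_motions.
Context {R : realType} {d : nat}.
Local Notation field := ('rV[R]_d -> 'rV[R]_d).
Implicit Types (x y : 'rV[R]_d) (w : field).

(** A scalar equal to its own transpose and to its opposite vanishes. *)
Lemma dotv_skew (Q : 'M[R]_d) (z : 'rV[R]_d) : Q^T = - Q ->
  dotv (z *m Q^T) z = 0.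
Proof.
move=> QT; have E : dotv (z *m Q^T) z = (z *m Q^T *m z^T) ord0 ord0.
  by rewrite [RHS]mxE; apply: eq_bigr => i _; rewrite [z^T _ _]mxE.
have : (z *m Q^T *m z^T)^T = - (z *m Q^T *m z^T).
  by rewrite !trmx_mul !trmxK QT mulmxN mulNmx opprK mulmxA.
by move=> /matrixP/(_ ord0 ord0); rewrite mxE [RHS]mxE -E; lra.
Qed.

Lemma rigid_motion_strain w x y : rigid_motion w ->
  dotv (w x) (dir y x) = dotv (w y) (dir y x).
Proof.
move=> [Q [c [QT ->]]]; apply/eqP; rewrite -subr_eq0 -dotvBl.
rewrite [X in dotv X _](_ : _ = - ((y - x) *m Q^T)); last first.
  by rewrite mulmxBl opprB opprD addrACA subrr addr0.
by rewrite dotvNl /dir dotvZr dotv_skew// mulr0 oppr0.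
Qed.

Lemma measurable_rigid_motion w : rigid_motion w -> measurable_fun setT w.
Proof.
move=> [Q [c [QT ->]]]; apply: measurable_funT_rV => i.
under eq_fun do rewrite !mxE.
apply: measurable_funD => //; apply: measurable_sum => j.
by apply: measurable_funM => //; exact: measurable_rV_coord.
Qed.

Lemma rigid_motion_bounded w (M : R) : rigid_motion w ->
  exists2 W, 0 <= W & forall x, enorm x <= M -> enorm (w x) <= W.
Proof.
move=> [Q [c [QT ->]]].
pose a i := \sum_j `|M| * `|Q^T j i| + `|c ord0 i|.
have a0 i : 0 <= a i by rewrite addr_ge0// sumr_ge0// => j _; rewrite mulr_ge0.
exists (d%:R * \sum_i a i) => [|x xM]; first by rewrite mulr_ge0// sumr_ge0.
apply: enorm_le_coord => i; rewrite !mxE.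
apply: (@le_trans _ _ (a i)); last by rewrite (bigD1 i)//= lerDl sumr_ge0.
apply: le_trans (ler_normD _ _) _; rewrite lerD2r.
apply: le_trans (ler_norm_sum _ _ _) _; apply: ler_sum => j _.
rewrite normrM ler_wpM2r//; apply: le_trans (ler_coord_enorm _ _) _.
exact: le_trans xM (ler_norm _).
Qed.

End rigid_motions.

Section V_theory.
Context {R : realType} {d : nat}.
Local Notation mu := (@lebesgue_rV R d).
Local Notation field := ('rV[R]_d -> 'rV[R]_d).
Implicit Types (x y : 'rV[R]_d) (u v w : field).

Variable (Om : set 'rV[R]_d).
Hypotheses (mOm : measurable Om) (bOm : exists M, forall x, Om x -> enorm x <= M).

Lemma finite_volume : (mu Om < +oo)%E.
Proof.
have [M OM] := bOm.
have M1 : 0 < `|M| + 1 by rewrite ltr_wpDl.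
apply: (@le_lt_trans _ _ (mu (cube 0 (`|M| + 1)))).
  apply: le_measure; rewrite ?inE//; first exact: measurable_cube.
  move=> x /OM xM i; have := le_trans (ler_coord_enorm x i) xM.
  have := ler_norm M; rewrite mxE /= in_itv/= ler_norml; lra.
by rewrite [ltLHS](volume_cube 0 M1) ltry.
Qed.

(** Membership of the closed ball of radius M of L^oo, stated without the
    extended real valued norm: triangle inequalities become pointwise. *)
Definition ebounded (M : R) u := {ae mu, forall x, Om x -> enorm (u x) <= M}.

Lemma norm_ooP M u : 0 <= M -> (norm_oo Om u <= M%:E)%E <-> ebounded M u.
Proof.
move=> M0; rewrite /norm_oo; split => [/ess_supP|h].
  by apply: filterS => x + xO; rewrite patchT ?inE// lee_fin.
apply/ess_supP; apply: filterS h => x h; rewrite /patch.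
by case: ifPn => [/set_mem/h|_]; rewrite lee_fin.
Qed.

Lemma volume_gt0 : (0 < mu setT)%E.
Proof.
have h := @volume_cube R d 0 1 ltr01.
apply: (@lt_le_trans _ _ (mu (cube 0 1))).
  by rewrite [ltRHS]h lte_fin exprn_gt0// mulr_gt0.
by apply: le_measure; rewrite ?inE//; exact: measurable_cube.
Qed.

(** The extension by 0 in the definition of the norm lives on the whole space,
    so it is the positivity of the total volume that matters, not that of
    Om. *)
Lemma norm_oo_ge0 u : (0 <= norm_oo Om u)%E.
Proof.
apply: ess_sup_gee; first exact: volume_gt0.
by apply: nearW => x; rewrite /patch; case: ifP => // _; rewrite lee_fin enorm_ge0.
Qed.

Lemma norm_oo_lty u : (norm_oo Om u < +oo)%E <-> exists2 M, 0 <= M & ebounded M u.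
Proof.
split=> [oo|[M M0 /(norm_ooP _ M0)]]; last by move/le_lt_trans; apply; rewrite ltry.
have f : norm_oo Om u \is a fin_num by rewrite ge0_fin_numE// norm_oo_ge0.
exists (fine (norm_oo Om u)); first exact: fine_ge0 (norm_oo_ge0 _).
by apply/norm_ooP; rewrite ?fineK// fine_ge0// norm_oo_ge0.
Qed.

Lemma eboundedD M N u v : ebounded M u -> ebounded N v -> ebounded (M + N) (u \+ v).
Proof.
apply: filterS2 => x ux vx xO; apply: le_trans (enormD _ _) _.
by apply: lerD; [exact: ux|exact: vx].
Qed.

Lemma eboundedN M u : ebounded M u -> ebounded M (\- u).
Proof. by apply: filterS => x ux xO; rewrite /= enormN ux. Qed.

Lemma eboundedB M N u v : ebounded M u -> ebounded N v -> ebounded (M + N) (u \- v).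
Proof. by move=> uM /eboundedN; exact: eboundedD. Qed.

Lemma ebounded_le M N u : M <= N -> ebounded M u -> ebounded N u.
Proof. by move=> MN; apply: filterS => x ux xO; exact: le_trans (ux xO) MN. Qed.

Lemma ebounded_eq M u v : field_eq Om u v -> ebounded M u -> ebounded M v.
Proof. by apply: filterS2 => x uv ux xO; rewrite -uv// ux. Qed.

Lemma ebounded0 M : 0 <= M -> ebounded M (cst 0).
Proof. by move=> M0; apply: nearW => x _; rewrite enorm0. Qed.

Lemma ebounded_sub0 u v : ebounded 0 (u \- v) -> field_eq Om u v.
Proof.
apply: filterS => x h xO; apply/eqP; rewrite -subr_eq0; apply/eqP.
by apply: enorm_eq0; apply/eqP; rewrite eq_le enorm_ge0 h.
Qed.

Lemma measurable_dotv_in u (w : field) : measurable_fun Om u -> measurable_fun setT w ->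
  measurable_fun Om (fun x => dotv (u x) (w x)).
Proof. by move=> mu_ mw; apply: measurable_dotv => //; exact: measurable_funTS. Qed.

Lemma integral_dotv_rigid_le u w M W : 0 <= M -> measurable_fun Om u ->
  ebounded M u -> rigid_motion w -> (forall x, Om x -> enorm (w x) <= W) ->
  (\int[mu]_(x in Om) `|(dotv (u x) (w x))%:E| <= (M * W)%:E * mu Om)%E.
Proof.
move=> M0 mu_ uM rw wW; rewrite -integral_cst//.
apply: ae_ge0_le_integral => //.
- apply: measurableT_comp => //; apply/measurable_EFinP.
  by apply: measurable_dotv_in => //; exact: measurable_rigid_motion.
- move=> x /wW xW; rewrite lee_fin mulr_ge0//.
  exact: le_trans (enorm_ge0 _) xW.
apply: filterS uM => x ux xO; rewrite lee_fin.
apply: le_trans (cauchy_schwarz _ _) _.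
by apply: ler_pM; rewrite ?enorm_ge0//; [exact: ux|exact: wW].
Qed.

Lemma integrable_dotv_rigid u w M : 0 <= M -> measurable_fun Om u ->
  ebounded M u -> rigid_motion w ->
  mu.-integrable Om (EFin \o (fun x => dotv (u x) (w x))).
Proof.
move=> M0 mu_ uM rw; have [D OD] := bOm.
have [W W0 wW] := rigid_motion_bounded D rw.
apply/integrableP; split.
  apply/measurable_EFinP; apply: measurable_dotv_in => //.
  exact: measurable_rigid_motion.
have OW x : Om x -> enorm (w x) <= W by move=> /OD/wW.
apply: le_lt_trans (integral_dotv_rigid_le M0 mu_ uM rw OW) _.
by rewrite lte_mul_pinfty ?lee_fin ?mulr_ge0//; exact: finite_volume.
Qed.

Lemma measurable_rVD_in u v : measurable_fun Om u -> measurable_fun Om v ->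
  measurable_fun Om (u \+ v).
Proof.
move=> mu_ mv; apply: measurable_funD_rV => // i; under eq_fun do rewrite mxE.
by apply: measurable_funD; exact: measurable_coord_comp.
Qed.

Lemma measurable_rVN_in u : measurable_fun Om u -> measurable_fun Om (\- u).
Proof.
move=> mu_; apply: measurable_funD_rV => // i; under eq_fun do rewrite mxE.
by apply: measurableT_comp => //; exact: measurable_coord_comp.
Qed.

Lemma Vspace_ebounded u : Vspace Om u -> exists2 M, 0 <= M & ebounded M u.
Proof. by case=> _ /norm_oo_lty. Qed.

Lemma Vspace_eq u v : (forall x, Om x -> u x = v x) -> Vspace Om v -> Vspace Om u.
Proof.
move=> uv [mv bv ov]; split.
- by apply: eq_measurable_fun mv => x /set_mem/uv.
- move/norm_oo_lty : bv => [M M0 vM]; apply/norm_oo_lty; exists M => //.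
  by apply: filterS vM => x vM xO; rewrite uv// vM.
- move=> w rw; rewrite -[RHS](ov w rw).
  by apply: eq_Rintegral => x /set_mem/uv ->.
Qed.

Lemma VspaceD u v : Vspace Om u -> Vspace Om v -> Vspace Om (u \+ v).
Proof.
move=> Vu Vv; have [M M0 uM] := Vspace_ebounded Vu.
have [N N0 vN] := Vspace_ebounded Vv.
case: Vu Vv => [mu_ _ ou] [mv _ ov]; split; first exact: measurable_rVD_in.
  by apply/norm_oo_lty; exists (M + N); [exact: addr_ge0|exact: eboundedD].
move=> w rw; under eq_Rintegral do rewrite dotvDl.
rewrite RintegralD//; last 2 first.
- exact: (integrable_dotv_rigid M0).
- exact: (integrable_dotv_rigid N0).
by rewrite ou// ov// addr0.
Qed.

Lemma VspaceN u : Vspace Om u -> Vspace Om (\- u).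
Proof.
move=> Vu; have [M M0 uM] := Vspace_ebounded Vu.
case: Vu => [mu_ _ ou]; split; first exact: measurable_rVN_in.
  by apply/norm_oo_lty; exists M => //; exact: eboundedN.
move=> w rw; under eq_Rintegral do rewrite dotvNl -mulN1r.
by rewrite RintegralZl ?ou ?mulr0//; exact: (integrable_dotv_rigid M0).
Qed.

Lemma VspaceB u v : Vspace Om u -> Vspace Om v -> Vspace Om (u \- v).
Proof. by move=> Vu /VspaceN; exact: VspaceD. Qed.

Lemma Vspace0 : Vspace Om (cst 0).
Proof.
split; first exact: measurable_cst.
  by apply/norm_oo_lty; exists 0 => //; exact: ebounded0.
move=> w rw; under eq_Rintegral do rewrite dot0v.
by rewrite Rintegral_cst// mul0r.
Qed.

(** On a bounded domain the work against a rigid motion is continuous for the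
    essential supremum norm. *)
Lemma Vspace_closed u : measurable_fun Om u ->
  (forall e, 0 < e -> exists2 v, Vspace Om v & ebounded e (u \- v)) ->
  Vspace Om u.
Proof.
move=> mu_ uv.
have uM : exists2 M, 0 <= M & ebounded M u.
  have [v Vv uv1] := uv 1 ltr01; have [M M0 vM] := Vspace_ebounded Vv.
  exists (1 + M); first exact: addr_ge0.
  apply: ebounded_eq (eboundedD uv1 vM); apply: nearW => x _ /=.
  exact: subrK.
split=> //; first exact/norm_oo_lty.
move=> w rw; have [D OD] := bOm; have [W W0 wW] := rigid_motion_bounded D rw.
have OW x : Om x -> enorm (w x) <= W by move=> /OD/wW.
have [M M0 ubM] := uM.
apply/eqP; rewrite -normr_eq0 eq_le normr_ge0 andbT; apply/ler_addgt0Pr => e e0.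
pose K := W * fine (mu Om) + 1.
have K0 : 0 < K by rewrite ltr_wpDl// mulr_ge0// fine_ge0.
have eK : 0 < e / K by rewrite divr_gt0.
have [v Vv uve] := uv _ eK; have [N N0 vN] := Vspace_ebounded Vv.
have [mv _ ov] := Vv.
have mV : measurable_fun Om (u \- v).
  by apply: measurable_rVD_in => //; exact: measurable_rVN_in.
have -> : \int[mu]_(x in Om) dotv (u x) (w x) =
    \int[mu]_(x in Om) dotv ((u \- v) x) (w x).
  under [RHS]eq_Rintegral do rewrite dotvBl.
  rewrite RintegralB ?ov ?subr0//.
  - exact: (integrable_dotv_rigid M0).
  - exact: (integrable_dotv_rigid N0).
have iV := integrable_dotv_rigid (ltW eK) mV uve rw.
rewrite -lee_fin EFin_normr_Rintegral// add0r.
apply: le_trans.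
  by apply: le_abse_integral => //; exact: measurable_int iV.
apply: le_trans (integral_dotv_rigid_le (ltW eK) mV uve rw OW) _.
have f : mu Om \is a fin_num by rewrite ge0_fin_numE//; exact: finite_volume.
rewrite -(fineK f) -EFinM lee_fin -mulrA mulrAC ler_pdivrMr// ler_pM2l//.
by rewrite lerDl.
Qed.

Section kernels.
Variables (eps c : R) (k : 'rV[R]_d -> 'rV[R]_d -> R).
Hypotheses (d1 : (1 < d)%N) (eps0 : 0 < eps) (c0 : 0 <= c).
Hypothesis kadm : admissible Om eps c k.

(** The work of the forces k(x, y) e against a rigid motion is the double
    integral of an antisymmetric function: rigid motions have no strain, so the
    component of w along the bond is the same at both ends, while the direction
    of the bond changes sign. *)
Lemma kop_rigid w : rigid_motion w ->
  \int[mu]_(x in Om) dotv (kop k x) (w x) = 0.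
Proof.
move=> rw; have [D OD] := bOm; have [W W0 wW] := rigid_motion_bounded D rw.
have [mk kC k0 kc] := kadm.
pose H (p : 'rV[R]_d * 'rV[R]_d) := k p.1 p.2 * dotv (w p.1) (dir p.2 p.1).
have mw : measurable_fun setT (fun p : 'rV[R]_d * 'rV[R]_d => w p.1).
  by apply: measurableT_comp; [exact: measurable_rigid_motion|exact: measurable_fst].
have mH : measurable_fun setT H.
  apply: measurable_funM => //; apply: measurable_dotv => //.
  by apply: measurable_funT_rV => i; exact: measurable_dir_coord.
have HC x y : H (y, x) = - H (x, y).
  by rewrite /H /= kC dirN dotvNr -(rigid_motion_strain _ _ rw) mulrN.
have mH1 x : measurable_fun setT (fun y => H (x, y)).
  exact: (measurableT_comp mH (pair1_measurable x)).
have Hdom : {ae mu, forall x, {ae mu, forall y,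
    `|H (x, y)| <= c * W * singular eps x y}}.
  apply: filterS kc => x; apply: filterS => y h; rewrite /H /= normrM mulrAC.
  have [xO|xO] := pselect (Om x); last first.
    by rewrite k0// normr0 mul0r !mulr_ge0// singular_ge0.
  apply: ler_pM => //; apply: le_trans (cauchy_schwarz _ _) _.
  apply: le_trans (ler_wpM2l _ (enorm_dir_le1 _ _)) _; first exact: enorm_ge0.
  by rewrite mulr1; apply/wW/OD.
have cW0 : 0 <= c * W by exact: mulr_ge0.
have iH : (mu \x mu)%E.-integrable setT (EFin \o H).
  apply/integrable12ltyP; first exact/measurable_EFinP.
  apply: (@le_lt_trans _ _ (\int[mu]_x
      ((c * W * singular_mass (d := d) eps)%:E * (\1_Om x)%:E))%E).
    apply: ae_ge0_le_integral => //.
    - by move=> x _; exact: integral_ge0.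
    - apply: (@measurable_fun_fubini_tonelli_F _ _ _ _ _ mu
        (fun p => `|(H p)%:E|)%E) => //.
      by apply: measurableT_comp => //; exact/measurable_EFinP.
    - by move=> x _; rewrite -EFinM lee_fin mulr_ge0// mulr_ge0// singular_mass_ge0.
    - by apply: measurable_funeM; apply/measurable_EFinP; exact: measurable_indic.
    apply: filterS Hdom => x h _; rewrite indicE.
    have [xO|xO] := pselect (Om x).
      rewrite mem_set// mule1.
      exact: (singular_dom_integral_le d1 eps0 cW0 (mH1 x) h).
    rewrite memNset// mule0 integral0_eq// => y _.
    by rewrite /H /= k0// mul0r normr0.
  rewrite ge0_integralZl//; last 2 first.
  - by apply/measurable_EFinP; exact: measurable_indic.
  - by rewrite lee_fin mulr_ge0// singular_mass_ge0.
  rewrite integral_indic// setIT.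
  have m0 : 0 <= c * W * singular_mass (d := d) eps.
    by apply: mulr_ge0 => //; exact: singular_mass_ge0.
  by rewrite lte_mul_pinfty ?lee_fin//; exact: finite_volume.
rewrite /Rintegral integral_mkcond.
rewrite (_ : integral _ _ _ = (\int[mu]_x \int[mu]_y (H (x, y))%:E)%E); last first.
  apply: ae_eq_integral => //.
  - apply/(measurable_restrictT _ mOm)/measurable_EFinP.
    apply: measurable_dotv_in.
      by apply: measurable_funTS; exact: measurable_kop kadm.
    exact: measurable_rigid_motion.
  - exact: (measurable_fubini_F iH).
  have ik := kop_integrand_integrable d1 eps0 c0 kadm.
  apply: filterS ik => x ix _; rewrite /patch; case: ifPn => [/set_mem xO|]; last first.
    move=> /negP xO; rewrite integral0_eq// => y _.
    by rewrite /H /= k0 ?mul0r// => /mem_set.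
  have fi i : (\int[mu]_y (k x y * dir y x ord0 i)%:E \is a fin_num)%E.
    exact: integrable_fin_num (ix i).
  under [RHS]eq_integral => y _.
    rewrite /H /dotv/= mulr_sumr -sumEFin.
    under eq_bigr => i _ do rewrite mulrCA EFinM.
    over.
  rewrite integral_sum//; last by move=> i; exact/integrableZl/ix.
  rewrite /dotv -sumEFin; apply: eq_bigr => i _.
  rewrite mxE mulrC EFinM integralZl//; last exact: ix.
  by rewrite fineK.
by rewrite integral_antisymmetric.
Qed.

Lemma Vspace_kop : Vspace Om (kop k).
Proof.
split; first by apply: measurable_funTS; exact: measurable_kop kadm.
- apply/norm_oo_lty; exists (d%:R * (c * singular_mass (d := d) eps)).
    by do 2 apply: mulr_ge0 => //; exact: singular_mass_ge0.
  by apply: filterS (kop_bounded d1 eps0 c0 kadm) => x + _.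
- exact: kop_rigid.
Qed.

End kernels.
End V_theory.

(** * The peridynamic kernels and the linearization remainder *)

(** The intermediate point is located without ordering a and b: it lies in
    every closed interval that contains both. *)
Lemma mean_value_bound {R : realType} (f : R -> R) :
  (forall r, derivable f r 1) -> forall a b,
  exists2 c, f a - f b = derive1 f c * (a - b) &
    forall z m, `|a - z| <= m -> `|b - z| <= m -> `|c - z| <= m.
Proof.
move=> df a b.
have fc : continuous f by move=> x; exact/differentiable_continuous/derivable1_diffP.
have H p q : p <= q -> exists2 c, f q - f p = derive1 f c * (q - p) & p <= c <= q.
  move=> pq; have [||c] := @MVT_segment R f (derive1 f) p q pq.
  - by move=> x _; apply: DeriveDef => //; rewrite derive1E.
  - by apply: continuous_subspaceT.
  by rewrite in_itv/= => cpq E; exists c.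
have [ab|ba] := leP a b.
  have [c E acb] := H _ _ ab; exists c; first by rewrite -(opprB b) mulrN -E opprB.
  by move=> z m; rewrite !ler_norml; lra.
have [c E acb] := H _ _ (ltW ba); exists c => //.
by move=> z m; rewrite !ler_norml; lra.
Qed.

(** The last estimate applies the mean value theorem to g' and then to g'':
    linearizing g' at a point z within m of both a and b leaves an error of
    second order. *)
Lemma potential_estimates {R : realType} (g : R -> R) : potential g ->
  exists2 M, 0 <= M &
  [/\ continuous (derive1n 1 g), continuous (derive1n 2 g),
      forall r, `|derive1n 1 g r| <= M, forall r, `|derive1n 2 g r| <= M &
      forall (a b z m : R), `|a - z| <= m -> `|b - z| <= m ->
      `|derive1n 1 g a - derive1n 1 g b - derive1n 2 g z * (a - b)| <=
        M * m * `|a - b|].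
Proof.
case=> -[dg _ bg] _ _ _ _.
have [M1 g1] := bg 1%N isT; have [M2 g2] := bg 2%N isT; have [M3 g3] := bg 3%N isT.
have M10 : 0 <= M1 by exact: le_trans (normr_ge0 _) (g1 0).
have M20 : 0 <= M2 by exact: le_trans (normr_ge0 _) (g2 0).
have M30 : 0 <= M3 by exact: le_trans (normr_ge0 _) (g3 0).
exists (M1 + M2 + M3); first lra.
have cg k : (k < 3)%N -> continuous (derive1n k g).
  by move=> k3 x; exact/differentiable_continuous/derivable1_diffP/dg.
split; [exact: cg|exact: cg| | |].
- by move=> r; have := g1 r; lra.
- by move=> r; have := g2 r; lra.
move=> a b z m az bz.
have [c -> cz] := mean_value_bound (dg 1%N isT) a b.
rewrite -mulrBl normrM ler_wpM2r//.
have [e E _] := mean_value_bound (dg 2%N isT) c z.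
rewrite [X in `|X|](_ : _ = derive1n 2 g c - derive1n 2 g z)// E normrM.
have m0 : 0 <= m by exact: le_trans (normr_ge0 _) az.
apply: ler_pM => //; last exact: cz.
by apply: le_trans (g3 e) _; rewrite lerDr addr_ge0.
Qed.

Section peridynamic_kernels.
Context {R : realType} {d : nat}.
Local Notation mu := (@lebesgue_rV R d).
Local Notation field := ('rV[R]_d -> 'rV[R]_d).
Implicit Types (x y : 'rV[R]_d) (u v w du : field).
Local Notation omega := (ball_volume (R := R) (d := d)).

Variables (g J : R -> R) (Om : set 'rV[R]_d) (eps : R).
Hypotheses (d1 : (1 < d)%N) (eps0 : 0 < eps) (mOm : measurable Om).

(** The mask that turns an integral over the horizon of x in Om into an
    integral over the whole space; it is symmetric in x and y. *)
Definition bond x y : bool := [&& x \in Om, y \in Om & enorm (y - x) < eps].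

Definition force_kernel u x y : R := if bond x y then
  2 * J (enorm (y - x) / eps) /
    (eps ^+ d.+1 * omega * Num.sqrt (enorm (y - x)))
  * derive1n 1 g (Num.sqrt (enorm (y - x)) * strain y x u) else 0.

Definition Dforce_kernel u du x y : R := if bond x y then
  2 * J (enorm (y - x) / eps) / (eps ^+ d.+1 * omega)
  * derive1n 2 g (Num.sqrt (enorm (y - x)) * strain y x u) * strain y x du
  else 0.

Lemma bondC x y : bond x y = bond y x.
Proof. by rewrite /bond enormB andbCA. Qed.

Lemma bondN x y : ~ Om x -> bond x y = false.
Proof. by move=> xO; rewrite /bond memNset. Qed.

Lemma vec_integral_kop (f : 'rV[R]_d -> 'rV[R]_d -> R) x : Om x ->
  vec_integral (eball x eps `&` Om) (fun y => f x y *: dir y x) =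
  kop (fun x y => if bond x y then f x y else 0) x.
Proof.
move=> xO; apply/rowP => i; rewrite !mxE Rintegral_mkcond.
apply: eq_Rintegral => y _; rewrite /patch in_setI /bond (mem_set xO) /=.
have -> : (y \in eball x eps) = (enorm (y - x) < eps).
  by apply/idP/idP => [/set_mem|h]; [|apply/mem_set].
by rewrite andbC; case: ifP => _; rewrite ?mul0r// [LHS]mxE.
Qed.

Lemma force_kop u x : Om x -> force g J Om eps u x = - kop (force_kernel u) x.
Proof. by move=> xO; rewrite -vec_integral_kop. Qed.

Lemma Dforce_kop u du x : Om x ->
  Dforce g J Om eps u du x = - kop (Dforce_kernel u du) x.
Proof. by move=> xO; rewrite -vec_integral_kop. Qed.

Lemma measurable_bond : measurable_fun setT
  (fun p : 'rV[R]_d * 'rV[R]_d => bond p.1 p.2).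
Proof.
have mO : measurable_fun setT (fun x : 'rV[R]_d => x \in Om).
  move=> _; apply: (measurable_fun_bool true) => //.
  rewrite setTI (_ : _ @^-1` _ = Om)//.
  by apply/seteqP; split => x /=; [exact: set_mem|exact: mem_set].
apply: measurable_and; first exact: measurableT_comp mO measurable_fst.
apply: measurable_and; first exact: measurableT_comp mO measurable_snd.
by apply: measurable_fun_ltr => //; exact: measurable_enorm measurable_fun_sndBfst.
Qed.

(** Outside Om a field carries no information; cutting it off there makes its
    strain measurable without changing it on bonds. *)
Lemma measurable_strain u : measurable_fun Om u ->
  measurable_fun setT (fun p : 'rV[R]_d * 'rV[R]_d =>
    if bond p.1 p.2 then strain p.2 p.1 u else 0).
Proof.
move=> mu_; pose v := patch (fun=> 0) Om u.
have mv : measurable_fun setT v.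
  by apply: measurable_patch_rV => // i; exact: measurable_coord_comp.
rewrite (_ : (fun _ => _) = (fun p => if bond p.1 p.2 then strain p.2 p.1 v else 0)).
  apply: measurable_fun_ifT => //; first exact: measurable_bond.
  apply: measurable_dotv; last first.
    by apply: measurable_funT_rV => i; exact: measurable_dir_coord.
  have mB : measurable_fun setT (fun p : 'rV[R]_d * 'rV[R]_d => v p.2 - v p.1).
    apply: measurable_rVB.
      exact: measurableT_comp mv measurable_snd.
    exact: measurableT_comp mv measurable_fst.
  apply: measurable_funT_rV => i; under eq_fun do rewrite mxE.
  apply: measurable_funM; last exact: measurable_coord_comp.
  apply: measurable_inv_ge0 => [p|]; first exact: enorm_ge0.
  exact: measurable_enorm measurable_fun_sndBfst.
apply/funext => -[x y] /=; rewrite /bond.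
case: ifP => // /and3P[/set_mem xO /set_mem yO _].
by rewrite /strain /v !patchT// inE.
Qed.

Lemma measurable_length :
  measurable_fun setT (fun p : 'rV[R]_d * 'rV[R]_d => enorm (p.2 - p.1)).
Proof. exact: measurable_enorm measurable_fun_sndBfst. Qed.

Lemma omega_ge0 : 0 <= omega.
Proof. by apply: fine_ge0; exact: measure_ge0. Qed.

Section estimates.
Variables (M MJ : R).
Hypotheses (M0 : 0 <= M) (MJ0 : 0 <= MJ).
Hypotheses (g1c : continuous (derive1n 1 g)) (g2c : continuous (derive1n 2 g)).
Hypotheses (g1M : forall r, `|derive1n 1 g r| <= M).
Hypotheses (g2M : forall r, `|derive1n 2 g r| <= M).
Hypothesis gtaylor : forall (a b z m : R), `|a - z| <= m -> `|b - z| <= m ->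
  `|derive1n 1 g a - derive1n 1 g b - derive1n 2 g z * (a - b)| <=
    M * m * `|a - b|.
Hypotheses (mJ : measurable_fun setT J) (J0 : forall r, 0 <= J r).
Hypothesis (JM : forall r, J r <= MJ).

Let E := eps ^+ d.+1 * omega.

Let E0 : 0 <= E.
Proof. by rewrite mulr_ge0 ?exprn_ge0 ?(ltW eps0)//; exact: omega_ge0. Qed.

Lemma measurable_force_kernel u : measurable_fun Om u -> measurable_fun setT
  (fun p : 'rV[R]_d * 'rV[R]_d => force_kernel u p.1 p.2).
Proof.
move=> mu_.
rewrite (_ : (fun _ => _) = (fun p => if bond p.1 p.2 then
    2 * J (enorm (p.2 - p.1) / eps) / (E * Num.sqrt (enorm (p.2 - p.1)))
    * derive1n 1 g (Num.sqrt (enorm (p.2 - p.1)) *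
        (if bond p.1 p.2 then strain p.2 p.1 u else 0)) else 0)); last first.
  by apply/funext => p; rewrite /force_kernel; case: ifP.
have ms := measurableT_comp measurable_sqrt measurable_length.
apply: measurable_fun_ifT => //; first exact: measurable_bond.
apply: measurable_funM.
  apply: measurable_funM.
    apply: measurable_funM => //; apply: measurableT_comp => //.
    by apply: measurable_funM => //; exact: measurable_length.
  apply: measurable_inv_ge0 => [p|]; first by rewrite mulr_ge0.
  by apply: measurable_funM.
apply: measurableT_comp; first exact: continuous_measurable_fun.
by apply: measurable_funM => //; exact: measurable_strain.
Qed.

Lemma measurable_Dforce_kernel u du :
  measurable_fun Om u -> measurable_fun Om du -> measurable_fun setT
  (fun p : 'rV[R]_d * 'rV[R]_d => Dforce_kernel u du p.1 p.2).
Proof.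
move=> mu_ mdu.
rewrite (_ : (fun _ => _) = (fun p => if bond p.1 p.2 then
    2 * J (enorm (p.2 - p.1) / eps) / E
    * derive1n 2 g (Num.sqrt (enorm (p.2 - p.1)) *
        (if bond p.1 p.2 then strain p.2 p.1 u else 0)) *
    (if bond p.1 p.2 then strain p.2 p.1 du else 0) else 0)); last first.
  by apply/funext => p; rewrite /Dforce_kernel; case: ifP.
have ms := measurableT_comp measurable_sqrt measurable_length.
apply: measurable_fun_ifT => //; first exact: measurable_bond.
apply: measurable_funM; last exact: measurable_strain.
apply: measurable_funM.
  apply: measurable_funM => //; apply: measurable_funM => //.
  apply: measurableT_comp => //.
  by apply: measurable_funM => //; exact: measurable_length.
apply: measurableT_comp; first exact: continuous_measurable_fun.
by apply: measurable_funM => //; exact: measurable_strain.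
Qed.

Lemma force_kernelC u x y : force_kernel u x y = force_kernel u y x.
Proof. by rewrite /force_kernel bondC enormB strainC. Qed.

Lemma Dforce_kernelC u du x y : Dforce_kernel u du x y = Dforce_kernel u du y x.
Proof. by rewrite /Dforce_kernel bondC enormB (strainC u) (strainC du). Qed.

Lemma admissibleB c1 c2 k1 k2 : admissible Om eps c1 k1 ->
  admissible Om eps c2 k2 ->
  admissible Om eps (c1 + c2) (fun x y => k1 x y - k2 x y).
Proof.
case=> m1 C1 s1 b1 [m2 C2 s2 b2]; split.
- exact: measurable_funB.
- by move=> x y; rewrite C1 C2.
- by move=> x y xO; rewrite s1// s2// subr0.
apply: filterS2 b1 b2 => x; apply: filterS2 => y h1 h2.
by rewrite mulrDl; apply: le_trans (ler_normB _ _) _; exact: lerD.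
Qed.

(** The force has the singularity r ^ (-1/2), which is r ^ (-3/2) up to a factor
    r <= eps. *)
Lemma force_kernel_admissible u : measurable_fun Om u ->
  admissible Om eps (2 * MJ * M * eps / E) (force_kernel u).
Proof.
move=> mu_; split.
- exact: measurable_force_kernel.
- exact: force_kernelC.
- by move=> x y xO; rewrite /force_kernel bondN.
have nn x y : 0 <= 2 * MJ * M * eps / E * singular eps x y.
  by rewrite !mulr_ge0 ?invr_ge0 ?singular_ge0 ?(ltW eps0).
apply: nearW => x; apply: nearW => y; rewrite /force_kernel.
case: ifPn => [|_]; last by rewrite normr0.
case/and3P=> _ _ re; rewrite /singular re.
set r := enorm (y - x) in re *; set D := derive1n 1 g _.
have r0 : 0 <= r by exact: enorm_ge0.
(* at r = 0 the inverses are 0 by convention, so both sides vanish *)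
have [->|rn0] := eqVneq r 0.
  by rewrite sqrtr0 !mulr0 invr0 !mulr0 mul0r normr0.
have rp : 0 < r by rewrite lt_def rn0.
have sp : 0 < Num.sqrt r by rewrite sqrtr_gt0.
rewrite -/E (invfM E) (invfM r) normrM ger0_norm; last first.
  by rewrite !mulr_ge0 ?invr_ge0.
have Ei0 : 0 <= E^-1 by rewrite invr_ge0.
set e := E^-1 in Ei0 *.
have -> : 2 * J (r / eps) * (e / Num.sqrt r) * `|D| =
  (2 * (J (r / eps) * `|D|) * r) * (e * (r^-1 / Num.sqrt r)) by field; lra.
have -> : 2 * MJ * M * eps * e * (r^-1 / Num.sqrt r) =
  (2 * (MJ * M) * eps) * (e * (r^-1 / Num.sqrt r)) by ring.
rewrite ler_wpM2r//.
  by rewrite !mulr_ge0 ?invr_ge0.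
apply: ler_pM => //; [by rewrite !mulr_ge0| |exact: ltW].
by rewrite ler_pM2l//; apply: ler_pM => //; exact: g1M.
Qed.

Lemma ebounded_bond u c : ebounded Om c u ->
  {ae mu, forall x, {ae mu, forall y, bond x y ->
    `|strain y x u| <= 2 * c / enorm (y - x)}}.
Proof.
move=> uc; apply: filterS (uc) => x ux; apply: filterS (uc) => y uy.
by case/and3P=> /set_mem xO /set_mem yO _; apply: strain_le; [exact: ux|exact: uy].
Qed.

(** The strain of du gives the singularity 1 / r, which is r ^ (-3/2) up to a
    factor sqrt r <= sqrt eps. *)
Lemma Dforce_kernel_admissible u du c : 0 <= c -> measurable_fun Om u ->
  measurable_fun Om du -> ebounded Om c du ->
  admissible Om eps (4 * MJ * M * c * Num.sqrt eps / E) (Dforce_kernel u du).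
Proof.
move=> c0 mu_ mdu duc; split.
- exact: measurable_Dforce_kernel.
- exact: Dforce_kernelC.
- by move=> x y xO; rewrite /Dforce_kernel bondN.
have nn x y : 0 <= 4 * MJ * M * c * Num.sqrt eps / E * singular eps x y.
  by rewrite !mulr_ge0 ?invr_ge0 ?singular_ge0 ?sqrtr_ge0.
apply: filterS (ebounded_bond duc) => x; apply: filterS => y.
rewrite /Dforce_kernel; case: ifPn => [|_ _]; last by rewrite normr0.
case/and3P=> _ _ re /(_ isT); rewrite /singular re.
set r := enorm (y - x) in re *; set D := derive1n 2 g _ => sle.
have r0 : 0 <= r by exact: enorm_ge0.
have [rz|rn0] := eqVneq r 0.
  move: sle; rewrite rz invr0 mulr0 normr_le0 => /eqP ->.
  by rewrite mulr0 normr0 mul0r invr0 mulr0.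
have rp : 0 < r by rewrite lt_def rn0.
have sp : 0 < Num.sqrt r by rewrite sqrtr_gt0.
rewrite -/E (invfM r) normrM [X in X * _]normrM ger0_norm; last first.
  by rewrite !mulr_ge0 ?invr_ge0.
have Ei0 : 0 <= E^-1 by rewrite invr_ge0.
set e := E^-1 in Ei0 *.
apply: (@le_trans _ _ (2 * MJ * e * M * (2 * c / r))).
  apply: ler_pM => //; first by rewrite !mulr_ge0 ?invr_ge0.
  apply: ler_pM => //; [by rewrite !mulr_ge0| |exact: g2M].
  by rewrite ler_wpM2r// ler_pM2l.
have -> : 2 * MJ * e * M * (2 * c / r) =
  (4 * MJ * M * c * e / r / Num.sqrt r) * Num.sqrt r by field; lra.
have -> : 4 * MJ * M * c * Num.sqrt eps * e * (r^-1 / Num.sqrt r) =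
  (4 * MJ * M * c * e / r / Num.sqrt r) * Num.sqrt eps by ring.
rewrite ler_wpM2l//; last exact/ler_wsqrtr/ltW.
by rewrite !mulr_ge0 ?invr_ge0.
Qed.

Definition remainder_kernel u0 u v x y :=
  force_kernel u x y - force_kernel v x y - Dforce_kernel u0 (u \- v) x y.

(** By the second order estimate on g', the remainder is a product of two
    factors sqrt r * strain, each of size r ^ (-1/2), with the weight
    r ^ (-1/2) of the force. The strains of u and v relative to u0 give the
    factor m, that of u relative to v gives the factor c. *)
Lemma remainder_kernel_admissible u0 u v m c : 0 <= m -> 0 <= c ->
  measurable_fun Om u0 -> measurable_fun Om u -> measurable_fun Om v ->
  measurable_fun Om (u \- v) ->
  ebounded Om m (u \- u0) -> ebounded Om m (v \- u0) -> ebounded Om c (u \- v) ->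
  admissible Om eps (8 * MJ * M * m * c / E) (remainder_kernel u0 u v).
Proof.
move=> m0 c0 mu0 mu_ mv muv um vm uvc; split.
- apply: measurable_funB; last exact: measurable_Dforce_kernel.
  by apply: measurable_funB; exact: measurable_force_kernel.
- move=> x y; rewrite /remainder_kernel (force_kernelC u) (force_kernelC v).
  by rewrite Dforce_kernelC.
- move=> x y xO.
  by rewrite /remainder_kernel /force_kernel /Dforce_kernel !bondN// !subr0.
have nn x y : 0 <= 8 * MJ * M * m * c / E * singular eps x y.
  by rewrite !mulr_ge0 ?invr_ge0 ?singular_ge0.
apply: filterS3 (ebounded_bond um) (ebounded_bond vm) (ebounded_bond uvc) => x.
apply: filterS3 => y.
rewrite /remainder_kernel /force_kernel /Dforce_kernel.
case: ifPn => [|_ _ _ _]; last by rewrite !subr0 normr0.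
case/and3P=> _ _ re /(_ isT) + /(_ isT) + /(_ isT); rewrite !strainB /singular re.
set r := enorm (y - x) in re *; rewrite -/E.
set Su := strain y x u; set Sv := strain y x v; set S0 := strain y x u0.
move=> hu hv huv.
have r0 : 0 <= r by exact: enorm_ge0.
have [rz|rn0] := eqVneq r 0.
  move: huv; rewrite rz invr0 mulr0 normr_le0 => /eqP ->.
  by rewrite sqrtr0 !mulr0 invr0 !mulr0 !mul0r !subr0 normr0.
have rp : 0 < r by rewrite lt_def rn0.
set s := Num.sqrt r.
have sp : 0 < s by rewrite sqrtr_gt0.
have ss : s * s = r by rewrite -expr2 sqr_sqrtr.
have h := gtaylor (a := s * Su) (b := s * Sv) (z := s * S0) (m := s * (2 * m / r)).
rewrite -!mulrBr !normrM (ger0_norm (ltW sp)) in h.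
have {h}h := h (ler_wpM2l (ltW sp) hu) (ler_wpM2l (ltW sp) hv).
rewrite (invfM E) (invfM r).
have Ei0 : 0 <= E^-1 by rewrite invr_ge0.
set e := E^-1 in Ei0 *.
set T := derive1n 1 g (s * Su) - derive1n 1 g (s * Sv)
  - derive1n 2 g (s * S0) * (s * (Su - Sv)) in h.
rewrite [X in `|X|](_ : _ = 2 * J (r / eps) * (e / s) * T); last first.
  by rewrite /T; field; lra.
rewrite normrM ger0_norm; last by rewrite !mulr_ge0 ?invr_ge0 ?(ltW sp).
have hT : `|T| <= M * (s * (2 * m / r)) * (s * (2 * c / r)).
  apply: le_trans h _; rewrite ler_wpM2l ?mulr_ge0 ?invr_ge0// ?(ltW sp)//.
  by rewrite ler_pM2l.
apply: (@le_trans _ _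
  (2 * MJ * (e / s) * (M * (s * (2 * m / r)) * (s * (2 * c / r))))).
  have Es : 0 <= e / s by rewrite mulr_ge0 ?invr_ge0// ltW.
  apply: ler_pM => //; first by apply: mulr_ge0 => //; exact: mulr_ge0.
  by rewrite ler_wpM2r// ler_pM2l.
by rewrite -ss le_eqVlt; apply/orP; left; apply/eqP; field; lra.
Qed.

Lemma Vspace_force u : (exists K, forall x, Om x -> enorm x <= K) ->
  measurable_fun Om u -> Vspace Om (force g J Om eps u).
Proof.
move=> bOm mu_; apply: (@Vspace_eq _ _ _ _ (\- kop (force_kernel u))).
  by move=> x xO; rewrite force_kop.
apply: VspaceN => //; apply: Vspace_kop (force_kernel_admissible mu_) => //.
by rewrite !mulr_ge0 ?invr_ge0 ?(ltW eps0).
Qed.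

Lemma Vspace_Dforce u du : (exists K, forall x, Om x -> enorm x <= K) ->
  measurable_fun Om u -> Vspace Om du -> Vspace Om (Dforce g J Om eps u du).
Proof.
move=> bOm mu_ Vdu; have [c c0 duc] := Vspace_ebounded Vdu.
have [mdu _ _] := Vdu.
apply: (@Vspace_eq _ _ _ _ (\- kop (Dforce_kernel u du))).
  by move=> x xO; rewrite Dforce_kop.
apply: VspaceN => //.
apply: Vspace_kop (Dforce_kernel_admissible c0 mu_ mdu duc) => //.
by rewrite !mulr_ge0 ?invr_ge0 ?sqrtr_ge0.
Qed.

Lemma Dforce_bounded u du c : 0 <= c -> measurable_fun Om u ->
  measurable_fun Om du -> ebounded Om c du ->
  ebounded Om (d%:R * (4 * MJ * M * Num.sqrt eps / E * singular_mass (d := d) eps) * c)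
    (Dforce g J Om eps u du).
Proof.
move=> c0 mu_ mdu duc.
have c0' : 0 <= 4 * MJ * M * c * Num.sqrt eps / E.
  by rewrite !mulr_ge0 ?invr_ge0 ?sqrtr_ge0.
have := kop_bounded d1 eps0 c0' (Dforce_kernel_admissible c0 mu_ mdu duc).
apply: filterS => x h xO; rewrite Dforce_kop// enormN; apply: le_trans h _.
by rewrite le_eqVlt; apply/orP; left; apply/eqP; ring.
Qed.

Lemma remainder_bounded u0 u v m c : 0 <= m -> 0 <= c ->
  Vspace Om u0 -> Vspace Om u -> Vspace Om v ->
  ebounded Om m (u \- u0) -> ebounded Om m (v \- u0) -> ebounded Om c (u \- v) ->
  ebounded Om (d%:R * (8 * MJ * M * m * c / E * singular_mass (d := d) eps))
    (force g J Om eps u \- force g J Om eps v \- Dforce g J Om eps u0 (u \- v)).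
Proof.
move=> m0 c0 [mu0 _ _] [mu_ _ _] [mv _ _] um vm uvc.
have muv : measurable_fun Om (u \- v).
  by apply: measurable_rVD_in => //; exact: measurable_rVN_in.
have c0' : 0 <= 8 * MJ * M * m * c / E by rewrite !mulr_ge0 ?invr_ge0.
have cf0 : 0 <= 2 * MJ * M * eps / E by rewrite !mulr_ge0 ?invr_ge0 ?(ltW eps0).
have cd0 : 0 <= 4 * MJ * M * c * Num.sqrt eps / E.
  by rewrite !mulr_ge0 ?invr_ge0 ?sqrtr_ge0.
have fu := force_kernel_admissible mu_; have fv := force_kernel_admissible mv.
have fD := Dforce_kernel_admissible c0 mu0 muv uvc.
have k1 := kopB d1 eps0 cf0 cf0 fu fv.
have k2 := kopB d1 eps0 (addr_ge0 cf0 cf0) cd0 (admissibleB fu fv) fD.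
have kb := kop_bounded d1 eps0 c0'
  (remainder_kernel_admissible m0 c0 mu0 mu_ mv muv um vm uvc).
apply: filterS3 k1 k2 kb => x h1 h2 h3 xO /=.
rewrite Dforce_kop// !force_kop//.
rewrite [X in enorm X](_ : _ = - kop (remainder_kernel u0 u v) x) ?enormN//.
rewrite /remainder_kernel h2 h1.
by move: (kop _ x) (kop _ x) (kop _ x) => p q r; rewrite !opprD !opprK.
Qed.

End estimates.
End peridynamic_kernels.

(** * The chord iteration *)

(** The factor 2^-1 ^+ n.+1 on the increments makes the tails sum to exactly
    2^-1 ^+ n. *)
Lemma geometric_increments_cvg {R : realType} (c : nat -> R) (K : R) : 0 <= K ->
  (forall n, `|c n.+1 - c n| <= K * 2^-1 ^+ n.+1) ->
  c @ \oo --> lim (c @ \oo) /\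
  forall n, `|lim (c @ \oo) - c n| <= K * 2^-1 ^+ n.
Proof.
move=> K0 cK.
have h n m : `|c (n + m)%N - c n| <= K * 2^-1 ^+ n - K * 2^-1 ^+ (n + m).
  elim: m => [|m IH]; first by rewrite addn0 !subrr normr0.
  rewrite addnS -(subrKA (c (n + m)%N)); apply: le_trans (ler_normD _ _) _.
  have := cK (n + m)%N; move: IH; rewrite !exprS.
  set p := 2^-1 ^+ (n + m); set q := 2^-1 ^+ n; lra.
have h' n m : `|c (n + m)%N - c n| <= K * 2^-1 ^+ n.
  apply: le_trans (h n m) _; rewrite lerBlDr lerDl mulr_ge0// exprn_ge0//.
have cvgc : cvg (c @ \oo).
  apply: cauchy_cvg; apply: cauchy_exP => e e0.
  have cz : K * 2^-1 ^+ n @[n --> \oo] --> K * 0.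
    by apply: cvgMr; apply: cvg_expr; rewrite ger0_norm//; lra.
  move: cz; rewrite mulr0 => /cvgrPdist_lt/(_ _ e0)[n _ /(_ n (leqnn n))].
  rewrite sub0r normrN => /(le_lt_trans (ler_norm _)) ne.
  exists (c n); exists n => // m /= nm; rewrite /ball/= distrC -(subnKC nm).
  exact: le_lt_trans (h' n _) ne.
split=> // n; apply/ler_addgt0Pr => e e0.
have /cvgrPdist_lt/(_ _ e0)[m _ hm] := cvgc.
have := hm (n + m)%N (leq_addl _ _) => /= hnm.
rewrite -(subrKA (c (n + m)%N)); apply: le_trans (ler_normD _ _) _.
by rewrite addrC; apply: lerD => //; exact: ltW.
Qed.

Section newton.
Context {R : realType} {d : nat}.
Local Notation mu := (@lebesgue_rV R d).
Local Notation field := ('rV[R]_d -> 'rV[R]_d).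
Implicit Types (u v w f : field).

Variable (Om : set 'rV[R]_d).
Hypotheses (mOm : measurable Om) (bOm : exists M, forall x, Om x -> enorm x <= M).
Local Notation ebounded := (ebounded Om).

(** Countably many almost everywhere bounds hold simultaneously. *)
Lemma ebounded_lim M K u : (forall n, ebounded (M + K * 2^-1 ^+ n) u) ->
  ebounded M u.
Proof.
move=> uM.
have : {ae mu, forall x, forall n, Om x -> enorm (u x) <= M + K * 2^-1 ^+ n}.
  by apply/ae_foralln => n; exact: uM.
apply: filterS => x h xO.
have cM : M + K * 2^-1 ^+ n @[n --> \oo] --> M + K * 0.
  apply: cvgD; first exact: cvg_cst.
  by apply: cvgMr; apply: cvg_expr; rewrite ger0_norm//; lra.
rewrite -[leRHS]addr0 -(mulr0 K) -(cvg_lim _ cM)//.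
apply: limr_ge; first by apply/cvg_ex; eexists; exact: cM.
by apply: nearW => n; exact: h.
Qed.

Lemma field_eq_sym u v : field_eq Om u v -> field_eq Om v u.
Proof. by apply: filterS => x uv xO; rewrite uv. Qed.

Lemma field_eq_trans u v w : field_eq Om u v -> field_eq Om v w -> field_eq Om u w.
Proof. by apply: filterS2 => x uv vw xO; rewrite uv// vw. Qed.

Lemma field_eq_ebounded u v : field_eq Om u v -> ebounded 0 (u \- v).
Proof. by apply: filterS => x uv xO /=; rewrite uv// subrr enorm0. Qed.

(** Off a null set the steps obey the given bounds; replacing them by 0 where
    they do not makes the partial sums converge everywhere, so that the limit
    is measurable. *)
Lemma Vspace_geometric_limit (u : nat -> field) (K : R) : 0 <= K ->
  (forall n, Vspace Om (u n)) ->
  (forall n, ebounded (K * 2^-1 ^+ n.+1) (u n.+1 \- u n)) ->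
  exists2 v, Vspace Om v &
    forall n, ebounded (d%:R * (K * 2^-1 ^+ n)) (v \- u n).
Proof.
move=> K0 Vu uK.
pose s n x := if enorm (u n.+1 x - u n x) <= K * 2^-1 ^+ n.+1
  then u n.+1 x - u n x else 0.
have mu_ n : measurable_fun Om (u n) by case: (Vu n).
have ms n : measurable_fun Om (s n).
  have mB : measurable_fun Om (u n.+1 \- u n).
    by apply: measurable_rVD_in => //; exact: measurable_rVN_in.
  apply: measurable_fun_if => //.
  - by apply: measurable_fun_ler => //; exact: measurable_enorm.
  - by apply: measurable_funS mB => // x [].
pose S n x := u 0%N x + \sum_(k < n) s k x.
have mS n : measurable_fun Om (S n).
  elim: n => [|n IH].
    rewrite (_ : S 0%N = u 0%N)//; apply/funext => x.
    by rewrite /S big_ord0 addr0.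
  rewrite (_ : S n.+1 = S n \+ s n); first exact: measurable_rVD_in.
  by apply/funext => x; rewrite /S big_ord_recr addrA.
have SS n x : S n.+1 x - S n x = s n x.
  rewrite /S big_ord_recr/= addrA; by rewrite [LHS]addrC addKr.
have sK n x : enorm (s n x) <= K * 2^-1 ^+ n.+1.
  by rewrite /s; case: ifP => // _; rewrite enorm0 mulr_ge0// exprn_ge0.
have Scoord i x n : `|S n.+1 x ord0 i - S n x ord0 i| <= K * 2^-1 ^+ n.+1.
  have := le_trans (ler_coord_enorm (s n x) i) (sK n x).
  by rewrite -SS !mxE.
pose v x : 'rV[R]_d := \row_i lim (S n x ord0 i @[n --> \oo]).
have vS n x : enorm (v x - S n x) <= d%:R * (K * 2^-1 ^+ n).
  apply: enorm_le_coord => i; rewrite !mxE.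
  have [_ /(_ n)] := geometric_increments_cvg K0 (Scoord i x).
  by rewrite /= mxE.
have mv : measurable_fun Om v.
  apply: measurable_funD_rV => // i.
  apply: (@measurable_fun_cvg _ _ _ Om (fun n x => S n x ord0 i)) => [n|x _].
    exact: measurable_coord_comp.
  have [+ _] := geometric_increments_cvg K0 (Scoord i x).
  by rewrite mxE.
have uS : {ae mu, forall x, Om x -> forall n, u n x = S n x}.
  have : {ae mu, forall x, forall n, Om x ->
      enorm ((u n.+1 \- u n) x) <= K * 2^-1 ^+ n.+1}.
    by apply/ae_foralln => n; exact: uK.
  apply: filterS => x h xO; elim=> [|n IH]; first by rewrite /S big_ord0 addr0.
  rewrite -[LHS](subrK (u n x)) {2}IH -(subrK (S n x) (S n.+1 x)) SS /s.
  by rewrite (h n xO).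
have uv n : ebounded (d%:R * (K * 2^-1 ^+ n)) (v \- u n).
  by apply: filterS uS => x h xO /=; rewrite h.
exists v => //; apply: Vspace_closed => // e e0.
have cz : d%:R * (K * 2^-1 ^+ n) @[n --> \oo] --> d%:R * (K * 0).
  by do 2 apply: cvgMr; apply: cvg_expr; rewrite ger0_norm//; lra.
move: cz; rewrite !mulr0 => /cvgrPdist_lt/(_ _ e0)[n _ /(_ n (leqnn n))].
rewrite sub0r normrN => /(le_lt_trans (ler_norm _))/ltW ne.
by exists (u n) => //; exact: ebounded_le ne (uv n).
Qed.

Section iteration.
Variables (L A B : field -> field) (u0 : field) (N kappa alpha rad : R).
Hypotheses (Vu0 : Vspace Om u0) (N0 : 0 <= N) (alpha0 : 0 <= alpha).
Hypotheses (kappa0 : 0 <= kappa) (rad0 : 0 <= rad) (Nkappa : N * kappa <= 2^-1).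
Hypotheses (VL : forall u, Vspace Om u -> Vspace Om (L u)).
Hypotheses (VA : forall u, Vspace Om u -> Vspace Om (A u)).
Hypothesis (AB : V_inverse Om A B).
Hypothesis (BN : forall f M, 0 <= M -> Vspace Om f -> ebounded M f ->
  ebounded (N * M) (B f)).
Hypothesis (Aalpha : forall w M, 0 <= M -> Vspace Om w -> ebounded M w ->
  ebounded (alpha * M) (A w)).
Hypothesis (Lkappa : forall u v M, 0 <= M -> Vspace Om u -> Vspace Om v ->
  ebounded rad (u \- u0) -> ebounded rad (v \- u0) -> ebounded M (u \- v) ->
  ebounded (kappa * M) (L u \- L v \- A (u \- v))).

(** Since A (u - v) is L u - L v up to a remainder that the bound on the
    inverse of A makes at most half as large as u - v, L is injective on the
    ball, with a Lipschitz inverse. *)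
Lemma newton_stability u v eta : 0 <= eta -> Vspace Om u -> Vspace Om v ->
  ebounded rad (u \- u0) -> ebounded rad (v \- u0) ->
  ebounded eta (L u \- L v) -> ebounded (2 * N * eta) (u \- v).
Proof.
move=> eta0 Vu Vv ur vr Luv.
have Vuv := VspaceB mOm bOm Vu Vv.
have fin : norm_oo Om (u \- v) \is a fin_num.
  by rewrite ge0_fin_numE ?norm_oo_ge0//; case: Vuv.
set M := fine (norm_oo Om (u \- v)).
have M0 : 0 <= M by rewrite fine_ge0// norm_oo_ge0.
have uvM : ebounded M (u \- v) by apply/norm_ooP; rewrite ?fineK.
have AM : ebounded (eta + kappa * M) (A (u \- v)).
  apply: ebounded_eq (eboundedB Luv (Lkappa M0 Vu Vv ur vr uvM)).
  by apply: nearW => x _ /=; rewrite opprB addrC subrK.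
have [_ _ _ BA] := AB.
have eM0 : 0 <= eta + kappa * M by rewrite addr_ge0// mulr_ge0.
have := ebounded_eq (BA _ Vuv) (BN eM0 (VA Vuv) AM).
move/(norm_ooP _ _ (mulr_ge0 N0 eM0)); rewrite -[X in (X <= _)%E -> _](fineK fin).
rewrite lee_fin -/M mulrDr mulrA => h.
apply: ebounded_le uvM.
have : N * kappa * M <= 2^-1 * M by rewrite ler_wpM2r.
lra.
Qed.

(** The chord iteration u + B (b - L u), with the inverse frozen at u0: the new
    residual is the linearization remainder of the last step, so the steps
    halve. The first one is at most rad / 2, hence the iterates stay in the
    ball. *)
Lemma newton_solution b beta : Vspace Om b -> 0 <= beta -> N * beta <= rad / 2 ->
  ebounded beta (b \- L u0) ->
  exists2 u, Vspace Om u /\ ebounded rad (u \- u0) & field_eq Om (L u) b.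
Proof.
move=> Vb beta0 Nbeta bL; have [VB _ ABf _] := AB.
pose step u := B (b \- L u).
have Vstep u : Vspace Om u -> Vspace Om (step u).
  by move=> Vu; apply/VB/VspaceB => //; exact: VL.
pose un n := iter n (fun u => u \+ step u) u0.
pose p n : R := 2^-1 ^+ n.
have p0 n : 0 <= p n by rewrite exprn_ge0.
have unS n : un n.+1 \- un n = step (un n).
  by apply/funext => x /=; rewrite addrAC subrr add0r.
have inv n : [/\ Vspace Om (un n), ebounded (rad * (1 - p n)) (un n \- u0) &
    ebounded (rad * p n.+1) (step (un n))] /\
    (forall n', n = n'.+1 -> ebounded (kappa * (rad * p n)) (b \- L (un n))).
  elim: n => [|n [[Vn un0 stn] _]].
    split=> //; split => //.
      apply: (@ebounded_le _ _ _ 0); first by rewrite /p expr0 subrr mulr0.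
      by apply: nearW => x _; rewrite /= subrr enorm0.
    apply: ebounded_le (BN beta0 (VspaceB mOm bOm Vb (VL Vu0)) bL).
    by rewrite /p expr1.
  have VS : Vspace Om (un n.+1) by apply: VspaceD => //; exact: Vstep.
  have unS0 : ebounded (rad * (1 - p n.+1)) (un n.+1 \- u0).
    apply: ebounded_eq (ebounded_le _ (eboundedD un0 stn)).
      by apply: nearW => x _ /=; rewrite addrAC.
    rewrite -mulrDr ler_wpM2l// /p exprS; set q := 2^-1 ^+ n; lra.
  have radn k : ebounded (rad * (1 - p k)) (un k \- u0) -> ebounded rad (un k \- u0).
    by apply: ebounded_le; rewrite ler_piMr// lerBlDr lerDl.
  have res : ebounded (kappa * (rad * p n.+1)) (b \- L (un n.+1)).
    have rp : 0 <= rad * p n.+1 by rewrite mulr_ge0.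
    have := Lkappa rp VS Vn (radn _ unS0) (radn _ un0).
    rewrite unS => /(_ stn) /eboundedN; apply: ebounded_eq.
    apply: filterS (ABf _ (VspaceB mOm bOm Vb (VL Vn))) => x h xO /=.
    by rewrite h//=; apply/rowP => i; rewrite !mxE; ring.
  split; last by move=> n' _.
  split=> //; apply: ebounded_le (BN _ (VspaceB mOm bOm Vb (VL VS)) res).
    rewrite [leRHS](_ : _ = 2^-1 * (rad * p n.+1)); last by rewrite /p exprS mulrCA.
    by rewrite mulrA; apply: ler_wpM2r => //; exact: mulr_ge0.
  by rewrite mulr_ge0// mulr_ge0.
have Vn n : Vspace Om (un n) by case: (inv n) => -[].
have [|u Vu uun] := Vspace_geometric_limit rad0 Vn.
  by move=> n; rewrite unS; case: (inv n) => -[].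
have unr n : ebounded rad (un n \- u0).
  case: (inv n) => -[_ h _] _; apply: ebounded_le h.
  by rewrite ler_piMr// lerBlDr lerDl.
have ur : ebounded rad (u \- u0).
  apply: (@ebounded_lim _ (d%:R * rad)) => n.
  apply: ebounded_eq (ebounded_le _ (eboundedD (unr n) (uun n))).
    by apply: nearW => x _ /=; rewrite addrC addrA subrK.
  by rewrite mulrA.
exists u => //; apply: ebounded_sub0.
pose K := kappa * (d%:R * rad) + alpha * (d%:R * rad) + kappa * rad.
apply: (@ebounded_lim _ K) => n; rewrite add0r.
pose m := d%:R * (rad * p n.+1).
have m0 : 0 <= m by rewrite !mulr_ge0.
have h1 := Lkappa m0 Vu (Vn n.+1) ur (unr n.+1) (uun n.+1).
have h2 := Aalpha m0 (VspaceB mOm bOm Vu (Vn n.+1)) (uun n.+1).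
have [_ /(_ n erefl) h3] := inv n.+1.
apply: ebounded_eq (ebounded_le _ (eboundedB (eboundedD h1 h2) h3)).
  by apply: nearW => x _ /=; rewrite subrK opprB addrA subrK.
rewrite /K /m /p exprS; set q := 2^-1 ^+ n.
have q0 : 0 <= q by exact: p0.
have k1 : 0 <= kappa * (d%:R * rad) * q by rewrite !mulr_ge0.
have k2 : 0 <= alpha * (d%:R * rad) * q by rewrite !mulr_ge0.
have k3 : 0 <= kappa * rad * q by rewrite !mulr_ge0.
lra.
Qed.

End iteration.
End newton.

(** * The inverse of the derivative, and the solution path *)

Section operator_norm.
Context {R : realType} {d : nat}.
Local Notation field := ('rV[R]_d -> 'rV[R]_d).
Variable (Om : set 'rV[R]_d).
Hypotheses (mOm : measurable Om) (bOm : exists M, forall x, Om x -> enorm x <= M).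

(** When all of V vanishes the norm is the supremum of the empty set, and its
    real part is 0. *)
Lemma op_norm_ge0 (B : field -> field) : 0 <= fine (op_norm Om B).
Proof.
have [[f [Vf f0]]|nf] := pselect (exists f, Vspace Om f /\ ~ field_eq Om f (cst 0)).
  apply: fine_ge0; apply: (@le_trans _ _
    (fine (norm_oo Om (B f)) / fine (norm_oo Om f))%:E).
    by rewrite lee_fin mulr_ge0 ?invr_ge0 ?fine_ge0// norm_oo_ge0.
  by apply: ereal_sup_ubound; exists f.
rewrite /op_norm (_ : [set _ | _ in _] = set0) ?ereal_sup0//.
by apply/seteqP; split => // x [f hf _]; apply: nf; exists f.
Qed.

(** The supremum runs over f that do not vanish almost everywhere; on the
    others B vanishes because it is the inverse of a map that sends 0 to 0. *)
Lemma op_norm_bound (A B : field -> field) : V_inverse Om A B ->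
  ebounded Om 0 (A (cst 0)) -> Vspace Om (A (cst 0)) ->
  (op_norm Om B < +oo)%E ->
  forall f M, 0 <= M -> Vspace Om f -> ebounded Om M f ->
  ebounded Om (fine (op_norm Om B) * M) (B f).
Proof.
move=> [VB Beq AB BA] A0 VA0 Boo f M M0 Vf fM.
have V0 := Vspace0 mOm.
have N0 := op_norm_ge0 B.
have [f0|f0] := pselect (field_eq Om f (cst 0)).
  have A00 : field_eq Om (A (cst 0)) (cst 0).
    apply: ebounded_sub0; apply: ebounded_eq A0.
    by apply: nearW => x _ /=; rewrite subr0.
  have B0 := field_eq_trans (Beq _ _ Vf V0 f0)
    (field_eq_trans (field_eq_sym (Beq _ _ VA0 V0 A00)) (BA _ V0)).
  apply: ebounded_eq (field_eq_sym B0) _; apply: ebounded0; exact: mulr_ge0.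
have finf : norm_oo Om f \is a fin_num.
  by rewrite ge0_fin_numE ?norm_oo_ge0//; case: Vf.
have finB : norm_oo Om (B f) \is a fin_num.
  by rewrite ge0_fin_numE ?norm_oo_ge0//; case: (VB _ Vf).
have fgt0 : 0 < fine (norm_oo Om f).
  rewrite lt_def fine_ge0 ?norm_oo_ge0// andbT; apply/eqP => f00; apply: f0.
  apply: ebounded_sub0; apply: (@ebounded_eq _ _ _ _ f).
    by apply: nearW => x _ /=; rewrite subr0.
  by apply/norm_ooP => //; rewrite -(fineK finf) f00.
have ub : ((fine (norm_oo Om (B f)) / fine (norm_oo Om f))%:E <= op_norm Om B)%E.
  by apply: ereal_sup_ubound; exists f.
have finN : op_norm Om B \is a fin_num.
  rewrite fin_numElt Boo andbT; apply: lt_le_trans ub; exact: ltNyr.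
move: ub; rewrite -[X in (_ <= X)%E](fineK finN) lee_fin ler_pdivrMr// => h.
apply/norm_ooP; first exact: mulr_ge0.
rewrite -(fineK finB) lee_fin; apply: le_trans h _; rewrite ler_wpM2l//.
by rewrite -lee_fin fineK//; apply/norm_ooP.
Qed.

End operator_norm.

Lemma powR_five_halves {R : realType} (eps : R) : 0 < eps ->
  eps `^ (5 / 2) = eps ^+ 2 * Num.sqrt eps.
Proof.
move=> eps0; rewrite (_ : 5 / 2 = 2%:R + 2^-1); last by field.
by rewrite powRD ?gt_eqF ?implybT// powR_mulrn ?powR12_sqrt// ltW.
Qed.

(** The mass eps ^ (d - 3/2) of the singular kernel over the weight
    eps ^ (d + 1) of the force leaves eps ^ (-5/2) in every dimension: this is
    where the exponent of the radius comes from. *)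
Lemma remainder_scaling {R : realType} (d : nat) (eps : R) (a b rad m w : R) :
  (1 < d)%N -> 0 < eps ->
  d%:R * (8 * a * b * rad * m / (eps ^+ d.+1 * w) * singular_mass (d := d) eps) <=
  d%:R * 8 * a * b * 2 ^+ (d + 4) / w * rad / (eps ^+ 2 * Num.sqrt eps) * m.
Proof.
move=> d1 eps0; have s0 : 0 < Num.sqrt eps by rewrite sqrtr_gt0.
have es : eps = Num.sqrt eps * Num.sqrt eps by rewrite -expr2 sqr_sqrtr// ltW.
have ed : eps ^+ d.+1 = eps ^+ d.-2 * eps ^+ 3.
  by rewrite -exprD; congr (_ ^+ _); lia.
have q0 : 0 < eps ^+ d.-2 by rewrite exprn_gt0.
rewrite /singular_mass ed !invfM; move: (eps ^+ d.-2) q0 => q q0.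
move: (w^-1) (2 ^+ (d + 4)) (d%:R) => w' p d'.
move: (Num.sqrt eps) s0 es => s s0 ->.
by rewrite le_eqVlt; apply/orP; left; apply/eqP; field; lra.
Qed.

Theorem theorem2 (R : realType) (d : nat) (hd : d = 2%N \/ d = 3%N)
    (g J : R -> R) (hg : potential g) (hJ : influence_function J) :
  exists2 C : R, 0 < C &
  forall (Om : set 'rV[R]_d) (hOm : bounded_domain Om)
    (hcone : interior_cone_condition Om)
    (eps : R) (heps : 0 < eps)
    (u0 b0 : 'rV[R]_d -> 'rV[R]_d)
    (hu0 : Vspace Om u0) (hb0 : Vspace Om b0)
    (hL0 : field_eq Om (force g J Om eps u0) b0)
    (Dinv : ('rV[R]_d -> 'rV[R]_d) -> ('rV[R]_d -> 'rV[R]_d))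
    (hDinv : V_inverse Om (Dforce g J Om eps u0) Dinv)
    (hbound : (op_norm Om Dinv < +oo)%E),
  let N := fine (op_norm Om Dinv) in
  let rad := C * eps `^ (5 / 2) / N in
  forall (T : R) (hT : 0 <= T) (b : R -> ('rV[R]_d -> 'rV[R]_d))
    (hbpath : V_path Om T b)
    (hbball : forall t, t \in `[0, T] -> Vball Om b0 (rad / (2 * N)) (b t)),
  exists2 u : R -> ('rV[R]_d -> 'rV[R]_d),
    solution_path g J Om eps T b u0 rad u &
    forall u' : R -> ('rV[R]_d -> 'rV[R]_d),
      solution_path g J Om eps T b u0 rad u' ->
      forall t, t \in `[0, T] -> field_eq Om (u' t) (u t).
Proof.
have d1 : (1 < d)%N by case: hd => ->.
have [M M0 [g1c g2c g1M g2M gtaylor]] := potential_estimates hg.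
have [mJ J0 [MJ JM] _] := hJ.
have MJ0 : 0 <= MJ by exact: le_trans (J0 0) (JM 0).
pose K : R := d%:R * 8 * MJ * M * 2 ^+ (d + 4) / ball_volume (R := R) (d := d).
have K0 : 0 <= K.
  by rewrite !mulr_ge0 ?invr_ge0 ?exprn_ge0 ?omega_ge0.
(* K is the constant of the linearization remainder; the added 1 keeps C
   positive when K vanishes *)
exists ((2 * (K + 1))^-1); first by rewrite invr_gt0; lra.
move=> Om [_ oOm _ bOm] _ eps eps0 u0 b0 Vu0 Vb0 L0 Dinv hDinv hbound.
move=> N rad T _ b hb hbball.
have mOm := open_measurable_rV oOm.
set L := force g J Om eps in L0 *.
set A := Dforce g J Om eps u0 in hDinv.
have N0 : 0 <= N by exact: op_norm_ge0.
have rad0 : 0 <= rad.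
  by rewrite !mulr_ge0 ?invr_ge0 ?powR_ge0//; lra.
have mu0 : measurable_fun Om u0 by case: Vu0.
have VL u : Vspace Om u -> Vspace Om (L u).
  by case=> mu_ _ _; exact: (Vspace_force d1 eps0 mOm M0 MJ0).
have VA u : Vspace Om u -> Vspace Om (A u).
  by move=> Vu; exact: (Vspace_Dforce d1 eps0 mOm M0 MJ0).
pose alpha := d%:R * (4 * MJ * M * Num.sqrt eps /
  (eps ^+ d.+1 * ball_volume (R := R) (d := d)) * singular_mass (d := d) eps).
have Vol0 : 0 <= ball_volume (R := R) (d := d) by exact: omega_ge0.
have mass0 : 0 <= singular_mass (d := d) eps by exact: singular_mass_ge0.
have E0 : 0 <= (eps ^+ d.+1 * ball_volume (R := R) (d := d))^-1.
  by rewrite invr_ge0 mulr_ge0// exprn_ge0// ltW.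
have alpha0 : 0 <= alpha.
  apply: mulr_ge0 => //; apply: mulr_ge0 => //; apply: mulr_ge0 => //.
  by rewrite !mulr_ge0.
have Aalpha w m : 0 <= m -> Vspace Om w -> ebounded Om m w ->
    ebounded Om (alpha * m) (A w).
  by move=> m0 [mw _ _]; exact: (Dforce_bounded d1 eps0 mOm M0 MJ0).
pose kappa := K * rad / (eps ^+ 2 * Num.sqrt eps).
have kappa0 : 0 <= kappa.
  apply: mulr_ge0; first exact: mulr_ge0.
  by rewrite invr_ge0 mulr_ge0// exprn_ge0// ltW.
(* if N vanishes so does rad, division by 0 being 0, and the iteration below is
   constant *)
have Nkappa : N * kappa <= 2^-1.
  rewrite /kappa /rad powR_five_halves//.
  have P0 : 0 < eps ^+ 2 * Num.sqrt eps by rewrite mulr_gt0 ?exprn_gt0 ?sqrtr_gt0.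
  move: (eps ^+ 2 * Num.sqrt eps) P0 => P P0.
  have [->|Nn0] := eqVneq N 0; first by rewrite mul0r invr_ge0.
  rewrite (_ : _ * _ = K / (2 * (K + 1))).
    by rewrite ler_pdivrMr; lra.
  by field; rewrite Nn0 !gt_eqF//; lra.
have Lkappa u v m : 0 <= m -> Vspace Om u -> Vspace Om v ->
    ebounded Om rad (u \- u0) -> ebounded Om rad (v \- u0) ->
    ebounded Om m (u \- v) ->
    ebounded Om (kappa * m) (L u \- L v \- A (u \- v)).
  move=> m0 Vu Vv ur vr uvm.
  apply: ebounded_le
    (remainder_bounded d1 eps0 mOm M0 MJ0 g1c g2c g1M g2M gtaylor mJ J0 JM
      rad0 m0 Vu0 Vu Vv ur vr uvm).
  exact: remainder_scaling.
have V0 := Vspace0 mOm.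
have A0 : ebounded Om 0 (A (cst 0)).
  by rewrite -(mulr0 alpha); apply: Aalpha => //; exact: ebounded0.
have BN := op_norm_bound mOm hDinv A0 (VA _ V0) hbound.
have b0L : field_eq Om b0 (L u0) := field_eq_sym L0.
pose beta := rad / (2 * N).
have beta0 : 0 <= beta by rewrite divr_ge0// mulr_ge0.
have Nbeta : N * beta <= rad / 2.
  have [->|Nn0] := eqVneq N 0; first by rewrite mul0r divr_ge0.
  by rewrite (_ : N * beta = rad / 2)// /beta; field; rewrite Nn0.
have sol t : exists u : 'rV[R]_d -> 'rV[R]_d, t \in `[0, T] ->
    [/\ Vspace Om u, ebounded Om rad (u \- u0) & field_eq Om (L u) (b t)].
  have [tT|] := boolP (t \in `[0, T]); last by exists u0.
  have [Vbt /(norm_ooP _ _ beta0) bt] := hbball _ tT.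
  have btL : ebounded Om beta (b t \- L u0).
    apply: ebounded_eq bt; apply: filterS b0L => x h xO /=.
    by rewrite h.
  have [u [Vu ur] Lu] := newton_solution mOm bOm Vu0 alpha0 kappa0 rad0 Nkappa
    VL hDinv BN Aalpha Lkappa Vbt beta0 Nbeta btL.
  by exists u.
have [u hu] := choice sol.
have stab := newton_stability mOm bOm N0 kappa0 Nkappa VA hDinv BN Lkappa.
exists u.
  split=> [t tT|t tT|t tT]; last 2 first.
  - by have [Vu ur _] := hu _ tT; split => //; apply/norm_ooP.
  - by have [_ _] := hu _ tT.
  have [Vu ur Lu] := hu _ tT; split=> //.
  have [Vbt bc] := hb _ tT.
  have lim0 : ((2 * N)%:E * norm_oo Om (b s \- b t)%R)%E
      @[s --> within [set` `[0, T]] (nbhs t)] --> 0%E.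
    by rewrite -(mule0 (2 * N)%:E); exact: cvgeZl.
  apply: (squeeze_cvge _ (cvg_cst 0%E) lim0); near=> s.
  have sT : s \in `[0, T] by near: s; exact: near_withinT.
  rewrite norm_oo_ge0/=; have [Vs sr Ls] := hu _ sT; have [Vbs _] := hb _ sT.
  have [_ Voo _] := VspaceB mOm bOm Vbs Vbt.
  have fin : norm_oo Om (b s \- b t) \is a fin_num.
    by rewrite ge0_fin_numE// norm_oo_ge0.
  have eta0 : 0 <= fine (norm_oo Om (b s \- b t)) by rewrite fine_ge0// norm_oo_ge0.
  have Lst : ebounded Om (fine (norm_oo Om (b s \- b t))) (L (u s) \- L (u t)).
    apply: (@ebounded_eq _ _ _ _ (b s \- b t)).
      by apply: filterS2 Ls Lu => x hs ht xO /=; rewrite hs// ht.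
    by apply/norm_ooP; rewrite ?fineK.
  rewrite -(fineK fin) -EFinM; apply/norm_ooP; first by rewrite !mulr_ge0.
  exact: stab.
move=> u' [_ ball' sol'] t tT.
have [Vu ur Lu] := hu _ tT; have [Vu' ur'] := ball' _ tT.
apply: ebounded_sub0; rewrite -(mulr0 (2 * N)).
apply: stab => //; first exact/(norm_ooP _ _ rad0).
apply: field_eq_ebounded; apply: field_eq_trans (sol' _ tT) _.
exact: field_eq_sym.
Unshelve. all: by end_near.
Qed.
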